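(* Let $X$ be a non-singular irreducible real algebraic set. Then the ring $\mathcal K^0(X)$ of continuous rational functions on $X$ is integrally closed in $\mathcal K(X)$.
   Context: A real algebraic set $X\subset\mathbb R^n$ is the set of common zeros in $\mathbb R^n$ of some polynomials; $\mathcal P(X)=\mathbb R[x_1,\dots,x_n]/\mathcal I(X)$, where $\mathcal I(X)$ is the ideal of polynomials vanishing on $X$, and for $X$ irreducible $\mathcal K(X)$ is the fraction field of $\mathcal P(X)$, i.e. the field of rational functions on $X$. A point $x\in X$ is non-singular if the localization of $\mathcal P(X)$ at the maximal ideal of functions vanishing at $x$ is a regular local ring; $X$ is non-singular if all its points are. A continuous rational function on $X$ is a function $f:X\to\mathbb R$, continuous for the Euclidean topology, such that there exist a Zariski-dense Zariski-open subset $U\subset X$ and polynomials $p,q$ with $q$ nowhere zero on $U$ and $f=p/q$ on $U$. These form the ring $\mathcal K^0(X)$; for $X$ irreducible and non-singular, sending $f$ to its class $p/q$ embeds $\mathcal K^0(X)$ in $\mathcal K(X)$. *)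

(* Defs.v *)
(* The notations of mpoly.v clash with those of MathComp-Analysis and are not
   imported: [mpoly n R] is {mpoly R[n]} and [meval v p] is p.@[v]. *)
From HB Require Import structures.
From mathcomp Require Import all_boot all_order all_algebra.
From mathcomp Require Import generic_quotient ring_quotient fraction mxpoly.
From mathcomp Require Import all_classical all_reals all_analysis.
From mathcomp Require Import -(notations) mpoly.
Import numFieldNormedType.Exports.
Import Order.TTheory GRing.Theory Num.Theory.

Set Implicit Arguments.
Unset Strict Implicit.
Unset Printing Implicit Defensive.

Local Open Scope classical_set_scope.
Local Open Scope ring_scope.
Local Open Scope quotient_scope.

Lemma subf_div (F : fieldType) (a c b d : F) : b != 0 -> d != 0 ->
  a / b - c / d = (a * d - c * b) / (b * d).
Proof. by move=> b0 d0; rewrite -mulNr addf_div // mulNr. Qed.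

Section RegularLocalRing.
Variable A : comNzRingType.

(* The library's [idealr A] and [prime_idealr A] are the types of proper ideals
   and of prime ideals of A, as boolean predicates; classically these are all
   proper (resp. prime) ideals. *)

Definition generated_by (s : seq A) : set A :=
  [set a | exists c : 'I_(size s) -> A, a = \sum_i c i * s`_i].

(* The unit ideal is generated by 1, so only proper ideals need be considered. *)
Definition noetherian : Prop :=
  forall I : idealr A, exists s : seq A, [set a | a \in I] = generated_by s.

Definition maximal_ideal (M : idealr A) : Prop :=
  forall I : idealr A, {subset M <= I} -> {subset I <= M}.

(* P_0 < P_1 < ... < P_d, strict inclusions *)
Definition has_prime_chain (d : nat) : Prop :=
  exists P : nat -> prime_idealr A, forall i, (i < d)%N ->
    {subset P i <= P i.+1} /\ ~ {subset P i.+1 <= P i}.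

Definition krull_dim (d : nat) : Prop :=
  has_prime_chain d /\ ~ has_prime_chain d.+1.

Definition regular_local_ring : Prop :=
  noetherian /\
  exists M : idealr A,
    [/\ maximal_ideal M,
        forall N : idealr A, maximal_ideal N -> N =i M
      & exists d : nat, krull_dim d /\
          exists2 s : seq A, size s = d & [set a | a \in M] = generated_by s].

End RegularLocalRing.

Section RealAlgebraicSets.
Variables (R : realType) (n : nat).
Local Notation poly := (mpoly n R).

Definition pval (p : poly) (x : 'rV[R]_n) : R := meval (x ord0) p.

Definition zeros (S : set poly) : set 'rV[R]_n :=
  [set x | forall p, S p -> pval p x = 0].

Definition real_algebraic (X : set 'rV[R]_n) : Prop :=
  exists S : set poly, X = zeros S.

Definition irreducible (X : set 'rV[R]_n) : Prop :=
  X !=set0 /\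
  forall Y Z, real_algebraic Y -> real_algebraic Z ->
    X = Y `|` Z -> X = Y \/ X = Z.

Definition zariski_open_in (X U : set 'rV[R]_n) : Prop :=
  exists2 Y, real_algebraic Y & U = X `\` Y.

(* X is contained in the Zariski closure of U *)
Definition zariski_dense_in (X U : set 'rV[R]_n) : Prop :=
  forall Y, real_algebraic Y -> U `<=` Y -> X `<=` Y.

Record irrAlgSet := IrrAlgSet {
  irr_set :> set 'rV[R]_n;
  irr_set_algebraic : real_algebraic irr_set;
  irr_set_irreducible : irreducible irr_set }.

Lemma pvalM p q x : pval (p * q) x = pval p x * pval q x.
Proof. exact: mevalM. Qed.

Lemma pvalD p q x : pval (p + q) x = pval p x + pval q x.
Proof. exact: mevalD. Qed.

Lemma pvalB p q x : pval (p - q) x = pval p x - pval q x.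
Proof. exact: mevalB. Qed.

Lemma pval0 x : pval 0 x = 0. Proof. exact: meval0. Qed.

Lemma pval1 x : pval 1 x = 1. Proof. exact: meval1. Qed.

Lemma real_algebraic1 p : real_algebraic [set x | pval p x = 0].
Proof.
exists [set p]; apply/seteqP; split=> x /=; last by apply.
by move=> px q ->.
Qed.

Lemma real_algebraic0 : real_algebraic set0.
Proof.
have [S SE] := real_algebraic1 1; exists S; rewrite -SE.
apply/seteqP; split=> // x /=; rewrite pval1 => /eqP.
by rewrite oner_eq0.
Qed.

Lemma real_algebraicI Y Z :
  real_algebraic Y -> real_algebraic Z -> real_algebraic (Y `&` Z).
Proof.
move=> [S ->] [T ->]; exists (S `|` T); apply/seteqP; split=> x.
  by move=> [xS xT] p [/xS|/xT].
by move=> xST; split=> p pS; apply: xST; [left|right].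
Qed.

Lemma real_algebraicU Y Z :
  real_algebraic Y -> real_algebraic Z -> real_algebraic (Y `|` Z).
Proof.
move=> [S ->] [T ->].
exists [set r | exists p q, [/\ S p, T q & r = p * q]]; apply/seteqP; split=> x.
  move=> [xS|xT] _ [p [q [Sp Tq ->]]]; rewrite pvalM.
    by rewrite (xS p) ?mul0r.
  by rewrite (xT q) ?mulr0.
move=> xST; have [xS|] := pselect (zeros S x); first by left.
move=> /existsNP[p /not_implyP[Sp px]]; right=> q Tq.
have /eqP : pval (p * q) x = 0 by apply: xST; exists p, q.
by rewrite pvalM mulf_eq0 => /orP[/eqP/px|/eqP].
Qed.

Lemma zariski_openI X U V :
  zariski_open_in X U -> zariski_open_in X V -> zariski_open_in X (U `&` V).
Proof.
move=> [Y algY ->] [Z algZ ->]; exists (Y `|` Z); first exact: real_algebraicU.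
apply/seteqP; split=> x.
  by move=> [[Xx Yx] [_ Zx]]; split=> // -[].
by move=> [Xx nYZ]; split; split=> // ?; apply: nYZ; [left|right].
Qed.

Lemma zariski_denseI X U V : V `<=` X ->
  zariski_open_in X U -> zariski_dense_in X U -> zariski_dense_in X V ->
  zariski_dense_in X (U `&` V).
Proof.
move=> VX [Y algY UE] dU dV Z algZ UVZ.
have VYZ : V `<=` Y `|` Z.
  move=> x Vx; have [Yx|nYx] := pselect (Y x); first by left.
  by right; apply: UVZ; split=> //; rewrite UE; split=> //; apply: VX.
apply: dU => // x; rewrite UE => -[Xx nYx].
by have [] := dV _ (real_algebraicU algY algZ) VYZ x Xx.
Qed.

End RealAlgebraicSets.

Section CoordinateRing.
Variables (R : realType) (n : nat) (X : irrAlgSet R n).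
Local Notation poly := (mpoly n R).

Definition vanishing_ideal (p : poly) : bool :=
  `[< forall x, irr_set X x -> pval p x = 0 >].

Lemma vanishing_ideal_closed : idealr_closed vanishing_ideal.
Proof.
have [[x Xx] _] := irr_set_irreducible X.
split.
- by apply/asboolP => y _; rewrite pval0.
- apply/negP => /asboolP /(_ x Xx) /eqP.
  by rewrite pval1 oner_eq0.
- move=> a p q /asboolP Ip /asboolP Iq; apply/asboolP => y Xy.
  by rewrite pvalD pvalM Ip // Iq // mulr0 addr0.
Qed.

Lemma vanishing_ideal_prime : prime_idealr_closed vanishing_ideal.
Proof.
move=> p q /asboolP Ipq.
have [_ irr] := irr_set_irreducible X.
have algX := irr_set_algebraic X.
have ap := real_algebraicI algX (real_algebraic1 p).
have aq := real_algebraicI algX (real_algebraic1 q).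
have XE : X = (X `&` [set x | pval p x = 0]) `|`
              (X `&` [set x | pval q x = 0]) :> set _.
  apply/seteqP; split=> [x Xx|x [] []//].
  have /eqP := Ipq x Xx; rewrite pvalM mulf_eq0.
  by move=> /orP[] /eqP ?; [left|right].
by apply/orP; have [E|E] := irr _ _ ap aq XE; [left|right];
  apply/asboolP => x; rewrite E => -[].
Qed.

HB.instance Definition _ :=
  isIdealr.Build poly vanishing_ideal vanishing_ideal_closed.
HB.instance Definition _ :=
  isPrimeIdealrClosed.Build poly vanishing_ideal vanishing_ideal_prime.

Definition vanishing_prime : prime_idealr poly := vanishing_ideal.

(* The ring P(X) of polynomial functions on X *)
Definition coord_ring : Type := {ideal_quot vanishing_prime}.

HB.instance Definition _ := GRing.ComNzRing.on coord_ring.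

Let coord_unit : {pred coord_ring} := fun a => `[< exists b, b * a = 1 >].
Let coord_inv (a : coord_ring) : coord_ring := xget a [set b | b * a = 1].

Let coord_mulVx : {in coord_unit, left_inverse 1 coord_inv *%R}.
Proof.
move=> a /asboolP[b ba]; rewrite /coord_inv.
by case: xgetP => [c _ //|/(_ b)].
Qed.

Let coord_unitPl (a b : coord_ring) : b * a = 1 -> coord_unit a.
Proof. by move=> ba; apply/asboolP; exists b. Qed.

Let coord_invr_out : {in [predC coord_unit], coord_inv =1 id}.
Proof.
move=> a /asboolP nua; rewrite /coord_inv.
by case: xgetP => // c _ ca; case: nua; exists c.
Qed.

HB.instance Definition _ := GRing.ComNzRing_hasMulInverse.Build coord_ring
  coord_mulVx coord_unitPl coord_invr_out.
HB.instance Definition _ := GRing.ComUnitRing_isIntegral.Build coord_ring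
  (@Quotient.rquot_IdomainAxiom _ vanishing_prime).

(* The restriction of a polynomial to X *)
Definition polyfun (p : poly) : coord_ring := \pi_{ideal_quot vanishing_prime} p.

(* The value at x of a polynomial function; it does not depend on the chosen
   representative when x is in X, see [coord_val_polyfun]. *)
Definition coord_val (x : 'rV[R]_n) (a : coord_ring) : R := pval (repr a) x.

Lemma polyfun0 : polyfun 0 = 0. Proof. exact: rmorph0. Qed.

Lemma polyfun_eq0 p : (polyfun p == 0) = vanishing_ideal p.
Proof.
by rewrite -polyfun0 -(Quotient.idealrBE vanishing_prime) subr0.
Qed.

Lemma polyfunP p q :
  polyfun p = polyfun q <-> (forall x, irr_set X x -> pval p x = pval q x).
Proof.
have := Quotient.idealrBE vanishing_prime p q => E.
split=> [/eqP|pq].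
  rewrite -E => /asboolP pq x Xx.
  by apply/eqP; rewrite -subr_eq0 -pvalB pq.
by apply/eqP; rewrite -E; apply/asboolP => x Xx; rewrite pvalB pq // subrr.
Qed.

Lemma polyfunD p q : polyfun (p + q) = polyfun p + polyfun q.
Proof. exact: rmorphD. Qed.

Lemma polyfunB p q : polyfun (p - q) = polyfun p - polyfun q.
Proof. exact: rmorphB. Qed.

Lemma polyfunM p q : polyfun (p * q) = polyfun p * polyfun q.
Proof. exact: rmorphM. Qed.

Lemma polyfun1 : polyfun 1 = 1. Proof. exact: rmorph1. Qed.

Lemma polyfun_repr (a : coord_ring) : polyfun (repr a) = a.
Proof. exact: reprK. Qed.

Lemma coord_val_polyfun x p : irr_set X x -> coord_val x (polyfun p) = pval p x.
Proof. by move=> Xx; apply: (polyfunP _ _).1 => //; rewrite polyfun_repr. Qed.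

(* The class of p / q in K(X) *)
Definition ratfun (p q : poly) : {fraction coord_ring} :=
  FracField.tofrac (polyfun p) / FracField.tofrac (polyfun q).

End CoordinateRing.

(* The field K(X) of rational functions on X *)
Notation rat_field X := {fraction coord_ring X}.

Section NonSingular.
Variables (R : realType) (n : nat) (X : irrAlgSet R n).

(* P(X) is a domain, so its localization at the maximal ideal of the functions
   vanishing at x is a subring of K(X). *)
Definition regular_at (x : X) (g : rat_field X) : bool :=
  `[< exists a b : coord_ring X, coord_val (val x) b != 0 /\
        g = FracField.tofrac a / FracField.tofrac b >].

Record local_ring (x : X) := LocalRing {
  local_val :> rat_field X;
  local_valP : regular_at x local_val }.

Variable x : X.

Let coord_valM (a b : coord_ring X) :
  coord_val (val x) (a * b) = coord_val (val x) a * coord_val (val x) b.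
Proof.
rewrite -(polyfun_repr a) -(polyfun_repr b) -polyfunM.
by rewrite !coord_val_polyfun ?pvalM //; exact/set_mem/(valP x).
Qed.

Let coord_val_neq0 (b : coord_ring X) : coord_val (val x) b != 0 -> FracField.tofrac b != 0.
Proof.
apply: contra_neq => /eqP; rewrite tofrac_eq0 => /eqP ->.
by rewrite -polyfun0 coord_val_polyfun ?pval0 //; exact/set_mem/(valP x).
Qed.

Lemma regular_at_subring : subring_closed (regular_at x).
Proof.
split.
- apply/asboolP; exists 1, 1; split; last by rewrite rmorph1 divr1.
  rewrite -polyfun1 coord_val_polyfun ?pval1 ?oner_eq0 //.
  exact/set_mem/(valP x).
- move=> _ _ /asboolP[a [b [b0 ->]]] /asboolP[c [d [d0 ->]]].
  apply/asboolP; exists (a * d - c * b), (b * d).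
  split; first by rewrite coord_valM mulf_neq0.
  by rewrite tofracB !tofracM subf_div ?coord_val_neq0.
- move=> _ _ /asboolP[a [b [b0 ->]]] /asboolP[c [d [d0 ->]]].
  apply/asboolP; exists (a * c), (b * d).
  split; first by rewrite coord_valM mulf_neq0.
  by rewrite !tofracM mulf_div.
Qed.

HB.instance Definition _ :=
  GRing.isSubringClosed.Build (rat_field X) (regular_at x) regular_at_subring.
HB.instance Definition _ := [isSub for @local_val x].
HB.instance Definition _ := [Choice of local_ring x by <:].
HB.instance Definition _ := [SubChoice_isSubComNzRing of local_ring x by <:].

End NonSingular.

Definition nonsingular (R : realType) (n : nat) (X : irrAlgSet R n) : Prop :=
  forall x : X, regular_local_ring (local_ring x).

Section ContinuousRational.
Variables (R : realType) (n : nat) (X : irrAlgSet R n).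
Local Notation poly := (mpoly n R).

(* f = p / q on some Zariski-dense Zariski-open subset of X *)
Definition is_fraction (f : X -> R) (p q : poly) : Prop :=
  exists U : set 'rV[R]_n,
    [/\ zariski_open_in X U, zariski_dense_in X U
      & forall x : X, U (val x) ->
          pval q (val x) != 0 /\ f x = pval p (val x) / pval q (val x)].

(* The topology on X is the one induced by that of R^n. *)
Definition continuous_rational (f : X -> R) : bool :=
  `[< continuous f /\ exists p q, is_fraction f p q >].

Let is_fraction2 (f g : X -> R) p q p' q' :
  is_fraction f p q -> is_fraction g p' q' ->
  exists U : set 'rV[R]_n,
    [/\ zariski_open_in X U, zariski_dense_in X U
      & forall x : X, U (val x) ->
          [/\ pval q (val x) != 0, f x = pval p (val x) / pval q (val x),
              pval q' (val x) != 0 & g x = pval p' (val x) / pval q' (val x)]].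
Proof.
move=> [U [oU dU Uf]] [V [oV dV Vg]]; exists (U `&` V); split.
- exact: zariski_openI.
- apply: zariski_denseI => //.
  by have [Y _ ->] := oV; exact: subDsetl.
- by move=> x [/Uf[? ?] /Vg[? ?]].
Qed.

Lemma is_fractionB f g p q p' q' :
  is_fraction f p q -> is_fraction g p' q' ->
  is_fraction (f - g) (p * q' - p' * q) (q * q').
Proof.
move=> fpq gpq; have [U [oU dU H]] := is_fraction2 fpq gpq.
exists U; split=> // x /H[q0 fx q'0 gx]; rewrite !(pvalM, pvalB) mulf_neq0 //.
split=> //; change ((f - g) x) with (f x - g x).
by rewrite fx gx subf_div.
Qed.

Lemma is_fractionM f g p q p' q' :
  is_fraction f p q -> is_fraction g p' q' ->
  is_fraction (f * g) (p * p') (q * q').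
Proof.
move=> fpq gpq; have [U [oU dU H]] := is_fraction2 fpq gpq.
exists U; split=> // x /H[q0 fx q'0 gx]; rewrite !pvalM mulf_neq0 //.
split=> //; change ((f * g) x) with (f x * g x).
by rewrite fx gx mulf_div.
Qed.

Lemma is_fraction1 : is_fraction 1 1 1.
Proof.
exists X; split.
- exists set0; first exact: real_algebraic0.
  by rewrite setD0.
- by move=> Y _.
- by move=> x _; rewrite pval1 oner_eq0 divr1.
Qed.

Lemma continuous_rational_subring : subring_closed continuous_rational.
Proof.
split.
- apply/asboolP; split; first exact: cst_continuous.
  by exists 1, 1; exact: is_fraction1.
- move=> f g /asboolP[cf [p [q fpq]]] /asboolP[cg [p' [q' gpq]]].
  apply/asboolP; split; first by move=> x; exact: (cvgB (cf x) (cg x)).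
  by do 2 eexists; exact: is_fractionB fpq gpq.
- move=> f g /asboolP[cf [p [q fpq]]] /asboolP[cg [p' [q' gpq]]].
  apply/asboolP; split; first by move=> x; exact: (cvgM (cf x) (cg x)).
  by do 2 eexists; exact: is_fractionM fpq gpq.
Qed.

HB.instance Definition _ :=
  GRing.isSubringClosed.Build (X -> R)%type continuous_rational
    continuous_rational_subring.

(* The ring K^0(X) *)
Record cont_rat := ContRat {
  cont_rat_val :> X -> R;
  cont_ratP : continuous_rational cont_rat_val }.

HB.instance Definition _ := [isSub for cont_rat_val].
HB.instance Definition _ := [Choice of cont_rat by <:].
HB.instance Definition _ :=
  GRing.SubChoice_isSubComPzRing.Build (X -> R)%type continuous_rational cont_rat
    continuous_rational_subring.

Let cont_rat1_neq0 : (1 : cont_rat) != 0.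
Proof.
apply/eqP => /(congr1 val); rewrite rmorph1 rmorph0 => E.
have [[x /mem_set Xx] _] := irr_set_irreducible X.
have /eqP := congr1 (fun f : X -> R => f (exist _ x Xx)) E.
by rewrite [_ == _]oner_eq0.
Qed.

HB.instance Definition _ :=
  GRing.PzSemiRing_isNonZero.Build cont_rat cont_rat1_neq0.

(* The class in K(X) of a continuous rational function: the common value of
   [ratfun X p q] for all its representations p / q, see [cont_rat_classE]. *)
Definition cont_rat_class (f : cont_rat) : rat_field X :=
  xget 0 [set g | exists p q, is_fraction f p q /\ g = ratfun X p q].

Lemma is_fraction_neq0 (f : X -> R) p q :
  is_fraction f p q -> FracField.tofrac (polyfun X q) != 0.
Proof.
move=> [U [[Y _ UE] dU H]]; rewrite tofrac_eq0 polyfun_eq0.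
apply/negP => /asboolP q0.
have [[x Xx] _] := irr_set_irreducible X.
apply: (dU set0 (real_algebraic0 R n) _ x Xx) => y Uy.
have Xy : irr_set X y by move: Uy; rewrite UE => -[].
have [] := H (exist _ y (mem_set Xy)) Uy.
by rewrite /= q0 // eqxx.
Qed.

Lemma is_fraction_inj (f : X -> R) p q p' q' :
  is_fraction f p q -> is_fraction f p' q' -> ratfun X p q = ratfun X p' q'.
Proof.
move=> fpq fpq'.
have q0 := is_fraction_neq0 fpq; have q'0 := is_fraction_neq0 fpq'.
apply/eqP; rewrite /ratfun (eqr_div _ _ q0 q'0) -!tofracM -!polyfunM.
have [U [[Y _ UE] dU H]] := is_fraction2 fpq fpq'.
apply/eqP; congr (FracField.tofrac _); apply/polyfunP => x Xx; apply/eqP; rewrite -subr_eq0 -pvalB; apply/eqP.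
apply: (dU _ (real_algebraic1 (p * q' - p' * q)) _ x Xx) => y Uy /=.
have Xy : irr_set X y by move: Uy; rewrite UE => -[].
have /= [qy -> q'y /eqP] := H (exist _ y (mem_set Xy)) Uy.
by rewrite (eqr_div _ _ qy q'y) pvalB !pvalM => /eqP ->; rewrite subrr.
Qed.

Lemma cont_rat_classE (f : cont_rat) p q :
  is_fraction f p q -> cont_rat_class f = ratfun X p q.
Proof.
move=> fpq; rewrite /cont_rat_class; case: xgetP => [_ _ [p' [q' [fpq' ->]]]|].
  exact: is_fraction_inj fpq' fpq.
by move=> /(_ (ratfun X p q)) []; exists p, q.
Qed.

Lemma cont_rat_class_zmod_morphism : zmod_morphism cont_rat_class.
Proof.
move=> f g.
have /asboolP[_ [p [q fpq]]] := cont_ratP f.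
have /asboolP[_ [p' [q' gpq]]] := cont_ratP g.
rewrite (cont_rat_classE (f := f - g) (is_fractionB fpq gpq)).
rewrite (cont_rat_classE fpq) (cont_rat_classE gpq) /ratfun.
rewrite (subf_div _ _ (is_fraction_neq0 fpq) (is_fraction_neq0 gpq)).
by rewrite polyfunB !polyfunM tofracB !tofracM.
Qed.

Lemma cont_rat_class_monoid_morphism : monoid_morphism cont_rat_class.
Proof.
split.
  rewrite (cont_rat_classE (f := 1) is_fraction1).
  by rewrite /ratfun polyfun1 tofrac1 divr1.
move=> f g.
have /asboolP[_ [p [q fpq]]] := cont_ratP f.
have /asboolP[_ [p' [q' gpq]]] := cont_ratP g.
rewrite (cont_rat_classE (f := f * g) (is_fractionM fpq gpq)).
rewrite (cont_rat_classE fpq) (cont_rat_classE gpq) /ratfun.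
by rewrite !polyfunM !tofracM mulf_div.
Qed.

HB.instance Definition _ :=
  GRing.isZmodMorphism.Build cont_rat (rat_field X) cont_rat_class
    cont_rat_class_zmod_morphism.
HB.instance Definition _ :=
  GRing.isMonoidMorphism.Build cont_rat (rat_field X) cont_rat_class
    cont_rat_class_monoid_morphism.

End ContinuousRational.

(* The image of A in K is integrally closed in K. *)
Definition integrally_closed_in (A K : nzRingType) (iota : {rmorphism A -> K}) :
    Prop :=
  forall z : K, integralOver iota z -> exists a : A, iota a = z.

(* Main.v *)
(** Let z = p/q be integral over K^0(X) and let x be a point of X. Where it is
    defined, z(y) is a root of a monic polynomial P_y whose coefficients are
    continuous in y. Hence z is bounded near x, and z(y) <> t for y near x as soon
    as t is not a root of P_x. So it suffices to prove that, for such t, z - t has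
    a constant sign near x: then z has a limit at every point x of X, and these
    limits form the continuous function sought.

    Let d be the dimension of the regular local ring at x. Since its maximal ideal
    has d generators, some equations H of X have at x a differential of rank at
    least n - d. A chain of d + 1 primes yields d independent R-derivations of
    K(X), so every equation of X has generically its differential in the span of
    those of H, and the vector fields tangent to H preserve the ideal of X. By the
    inverse function theorem, two points of X near x are joined by a curve in
    H = 0 which a polynomial chart sends to a segment, and by Gronwall's inequality
    it stays in X. Along this curve q has zeros of finite order only, because a
    multiple of q is a nonzero polynomial in the tangent coordinates, which are
    affine in the parameter. Dividing p and q by the same power of the parameter,
    the bounded function p/q extends continuously to the curve. The extension is
    still a root of P, so it avoids t, and the intermediate value theorem
    concludes. *)
Require Import Defs.
From HB Require Import structures.
From mathcomp Require Import all_boot all_order all_algebra.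
From mathcomp Require Import generic_quotient ring_quotient fraction mxpoly.
From mathcomp Require Import all_classical all_reals all_analysis.
From mathcomp Require Import -(notations) mpoly.
From mathcomp Require Import ring lra zify.

Import Order.TTheory GRing.Theory Num.Theory.
Import numFieldNormedType.Exports.

Set Implicit Arguments.
Unset Strict Implicit.
Unset Printing Implicit Defensive.

Local Open Scope classical_set_scope.
Local Open Scope quotient_scope.
Local Open Scope ring_scope.

(** * Hilbert's basis theorem *)

Lemma mpoly_ring_ind (n : nat) (A : comNzRingType) (P : mpoly n A -> Prop) :
  (forall c, P (mpolyC n c)) -> (forall i, P (mpolyX A (mnm1 i))) ->
  (forall p q, P p -> P q -> P (p + q)) ->
  (forall p q, P p -> P q -> P (p * q)) -> forall p, P p.
Proof.
move=> PC PX PD PM; apply: mpolyind => [|c m p _ _ Pp].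
  by rewrite -(mpolyC0 n A); exact: PC.
apply: (PD) => //; rewrite -mul_mpolyC mpolyXE_id; apply: (PM) => //.
apply: (big_ind P) => // [|i _]; first by rewrite -(mpolyC1 n A); exact: PC.
elim: (m i) => [|k IHk]; first by rewrite expr0 -(mpolyC1 n A); exact: PC.
by rewrite exprS; exact: PM.
Qed.

Section Ideals.
Variable A : comNzRingType.
Implicit Types (I : set A) (s : seq A).

Definition is_ideal I :=
  [/\ I 0, forall a b, I a -> I b -> I (a + b) & forall a b, I b -> I (a * b)].

(* Unlike [noetherian], this includes the unit ideal. *)
Definition ideals_fg := forall I, is_ideal I -> exists s, I = generated_by s.

Lemma ideal_sum I (J : Type) (r : seq J) (P : pred J) (F : J -> A) :
  is_ideal I -> (forall j, P j -> I (F j)) -> I (\sum_(j <- r | P j) F j).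
Proof. by move=> [I0 ID _] IF; exact: (big_ind I). Qed.

Lemma idealB I a b : is_ideal I -> I a -> I b -> I (a - b).
Proof. by move=> [_ ID IM] Ia Ib; apply: ID => //; rewrite -mulN1r; exact: IM. Qed.

Lemma generated_by_ideal s : is_ideal (generated_by s).
Proof.
split.
- by exists (fun=> 0); rewrite big1 // => i _; rewrite mul0r.
- move=> a b [c ->] [d ->]; exists (fun i => c i + d i).
  by rewrite -big_split; apply: eq_bigr => i _; rewrite mulrDl.
- move=> a b [c ->]; exists (fun i => a * c i).
  by rewrite mulr_sumr; apply: eq_bigr => i _; rewrite mulrA.
Qed.

Lemma mem_generated_by s a : a \in s -> generated_by s a.
Proof.
move=> sa; have lts : (index a s < size s)%N by rewrite index_mem.
exists (fun i => (i == Ordinal lts)%:R); rewrite (bigD1 (Ordinal lts)) //=.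
rewrite eqxx mul1r nth_index // big1 ?addr0 // => i /negbTE ->.
by rewrite mul0r.
Qed.

Lemma generated_by_min I s : is_ideal I -> (forall a, a \in s -> I a) ->
  generated_by s `<=` I.
Proof.
move=> idI Is _ [c ->]; apply: ideal_sum => // i _.
by case: (idI) => _ _; apply; apply: Is; exact: mem_nth.
Qed.

(** Ascending chain condition: the ideals of the prefixes of the sequence have a finitely generated
    union, and its generators already lie in one of them. *)
Lemma ideals_fg_seq : ideals_fg -> forall a : nat -> A,
  exists m (c : 'I_m -> A), a m = \sum_(i < m) c i * a i.
Proof.
move=> fgA a; pose J N := generated_by (mkseq a N).
have memJ N i : (i < N)%N -> J N (a i).
  by move=> iN; apply: mem_generated_by; apply: map_f; rewrite mem_iota.
have leJ M N : (M <= N)%N -> J M `<=` J N.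
  move=> MN; apply: generated_by_min; first exact: generated_by_ideal.
  move=> x /mapP[i]; rewrite mem_iota /= add0n => iM ->.
  by apply: memJ; exact: leq_trans MN.
have idI : is_ideal [set x | exists N, J N x].
  split.
  - by exists 0; case: (generated_by_ideal (mkseq a 0)).
  - move=> x y [M JMx] [N JNy]; exists (maxn M N).
    case: (generated_by_ideal (mkseq a (maxn M N))) => _ + _; apply.
      by apply: leJ JMx; exact: leq_maxl.
    by apply: leJ JNy; exact: leq_maxr.
  - by move=> x y [N JNy]; exists N; case: (generated_by_ideal (mkseq a N)) => _ _; apply.
have [s sE] := fgA _ idI.
have [N sN] : exists N, forall x, x \in s -> J N x.
  have : forall x, x \in s -> exists N, J N x.
    move=> x xs; suff: [set x | exists N, J N x] x by [].
    by rewrite sE; exact: mem_generated_by.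
  elim: s {sE} => [|y s IHs] Js; first by exists 0.
  have [M JM] := IHs (fun x xs => Js x (mem_behead (s := y :: s) xs)).
  have [N JN] := Js y (mem_head y s); exists (maxn M N) => x.
  rewrite inE => /orP[/eqP ->|/JM]; first by apply: leJ JN; exact: leq_maxr.
  by apply: leJ; exact: leq_maxl.
have JNN : J N (a N).
  apply: (generated_by_min (generated_by_ideal _) sN); rewrite -sE.
  by exists N.+1; exact: memJ.
have [c cE] := JNN; exists N; move: c cE; rewrite size_mkseq => c ->; exists c.
by apply: eq_bigr => i _; rewrite nth_mkseq.
Qed.

End Ideals.

(** An ideal of [B] is generated by the images of generators of its preimage. *)
Lemma ideals_fg_surj (A B : comNzRingType) (f : {rmorphism A -> B}) :
  (forall b, exists a, f a = b) -> ideals_fg A -> ideals_fg B.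
Proof.
move=> fS fgA I idI; have [I0 ID IM] := idI.
have [|s sE] := fgA [set a | I (f a)].
  split=> [|a b|a b] /=; rewrite ?rmorph0 ?rmorphD ?rmorphM //; [exact: ID|exact: IM].
exists (map f s); apply/seteqP; split; last first.
  apply: generated_by_min => // _ /mapP[a sa ->].
  suff: [set a | I (f a)] a by []; rewrite sE; exact: mem_generated_by.
move=> b; have [a <-] := fS b => Ifa.
have [c ->] : generated_by s a by rewrite -sE.
rewrite rmorph_sum; apply: ideal_sum => [|i _]; first exact: generated_by_ideal.
rewrite rmorphM; case: (generated_by_ideal (map f s)) => _ _; apply.
by apply: mem_generated_by; apply: map_f; exact: mem_nth.
Qed.

Lemma ideals_fg_field (F : fieldType) : ideals_fg F.
Proof.
move=> I idI; have [I0 ID IM] := idI.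
have [[a [Ia a0]]|nI] := pselect (exists a, I a /\ a != 0).
  exists [:: a]; apply/seteqP; split; last first.
    by apply: generated_by_min => // b; rewrite inE => /eqP ->.
  by move=> b _; exists (fun=> b / a); rewrite big_ord_recl big_ord0 /= divfK ?addr0.
exists [::]; apply/seteqP; split=> [b Ib|]; last exact: generated_by_min.
exists (fun=> 0); rewrite big_ord0; apply/eqP/negPn/negP => b0.
by apply: nI; exists b.
Qed.

(* Hilbert's basis theorem: a sequence of elements of minimal degree outside the
   ideal generated by the previous ones has leading coefficients none of which
   is a combination of the previous ones. *)
Lemma ideals_fg_poly (A : comNzRingType) : ideals_fg A -> ideals_fg {poly A}.
Proof.
move=> fgA I idI; have [I0 ID IM] := idI; apply: contrapT => nfg.
pose good s f := [/\ I f, ~ generated_by s f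
  & forall g, I g -> ~ generated_by s g -> (size f <= size g)%N].
have ex s : exists f, (forall a, a \in s -> I a) -> good s f.
  have [Is|nIs] := pselect (forall a, a \in s -> I a); last by exists 0.
  have [f0 [If0 nf0]] : exists f, I f /\ ~ generated_by s f.
    apply: contrapT => nf; apply: nfg; exists s; apply/seteqP; split.
      by move=> f If; apply: contrapT => nsf; apply: nf; exists f.
    exact: generated_by_min.
  pose P k := `[< exists f, [/\ I f, ~ generated_by s f & size f = k] >].
  have exP : exists k, P k by exists (size f0); apply/asboolP; exists f0.
  case: (ex_minnP exP) => k /asboolP[f [If nf sf]] kmin; exists f => _; split=> // g Ig ng.
  by rewrite sf; apply: kmin; apply/asboolP; exists g.
have [nxt nxtP] := choice ex.
pose S k := iter k (fun s => rcons s (nxt s)) [::].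
have IS k : forall a, a \in S k -> I a.
  elim: k => //= k IHk a; rewrite mem_rcons inE => /orP[/eqP ->|]; last exact: IHk.
  by case: (nxtP _ IHk).
pose f k : {poly A} := nxt (S k).
have fP k : good (S k) (f k) by apply: nxtP; exact: IS.
have fS i k : (i < k)%N -> f i \in S k.
  elim: k => // k IHk; rewrite ltnS leq_eqVlt /= mem_rcons inE.
  by case/orP=> [/eqP ->|/IHk ->]; rewrite ?eqxx ?orbT.
have subS i k : (i <= k)%N -> generated_by (S i) `<=` generated_by (S k).
  move=> ik; apply: generated_by_min; first exact: generated_by_ideal.
  move=> a aS; apply: mem_generated_by; elim: k ik => [|k IHk].
    by rewrite leqn0 => /eqP <-.
  rewrite leq_eqVlt => /orP[/eqP <- //|/IHk aSk].
  by rewrite /= mem_rcons inE aSk orbT.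
have [m [c cE]] := ideals_fg_seq fgA (fun k => lead_coef (f k)).
have [Ifm nfm fmin] := fP m.
have fm0 : f m != 0.
  by apply/eqP => fm0; apply: nfm; rewrite fm0; case: (generated_by_ideal (S m)).
have szf i : (i < m)%N -> (size (f i) <= size (f m))%N.
  move=> im; case: (fP i) => _ _; apply => // gf; apply: nfm.
  exact: (subS i m (ltnW im)).
(* By [cE] this combination of the earlier [f i] has the size and leading coefficient of [f m]. So
   [f m - g] is smaller but still outside the ideal they generate, against minimality. *)
pose g : {poly A} := \sum_(i < m) (c i *: 'X^(size (f m) - size (f i))) * f i.
have gS : generated_by (S m) g.
  apply: ideal_sum => [|i _]; first exact: generated_by_ideal.
  case: (generated_by_ideal (S m)) => _ _; apply.
  by apply: mem_generated_by; exact: fS.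
have Ig : I g.
  by apply: ideal_sum => // i _; apply: IM; case: (fP i).
have := fmin (f m - g) (idealB idI Ifm Ig).
have sm : (0 < size (f m))%N by rewrite size_poly_gt0.
suff: (size (f m - g)%R < size (f m))%N.
  rewrite ltnNge => /negP lt le; apply: lt; apply: le => ngfg; apply: nfm.
  have -> : f m = (f m - g) + g by rewrite subrK.
  by case: (generated_by_ideal (S m)) => _ + _; apply.
rewrite -(prednK sm) ltnS; apply/leq_sizeP => j.
rewrite leq_eqVlt coefB coef_sum => /orP[/eqP <-|lj].
  rewrite -/(lead_coef (f m)) cE -sumrB big1 // => i _.
  rewrite -scalerAl coefZ coefXnM ltnNge.
  have si : (size (f m) - size (f i) <= (size (f m)).-1)%N.
    have fi0 : f i != 0.
      apply/eqP => fi0; case: (fP i) => _ + _; apply; rewrite fi0.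
      by case: (generated_by_ideal (S i)).
    have := szf i (ltn_ord i); move: sm; rewrite -size_poly_gt0 in fi0.
    by move: fi0; move: (size (f m)) (size (f i)) => a b; lia.
  rewrite si /= (_ : _ - _ = (size (f i)).-1)%N ?subrr //.
  have := szf i (ltn_ord i); move: si sm.
  by move: (size (f m)) (size (f i)) => a b; lia.
rewrite prednK // in lj; rewrite nth_default // big1 ?subrr // => i _.
rewrite -scalerAl coefZ coefXnM; case: ltnP => [_|_]; rewrite ?mulr0 //.
rewrite [_`_(j - _)]nth_default ?mulr0 //.
have := szf i (ltn_ord i); move: lj.
by move: (size (f m)) (size (f i)) => a b; lia.
Qed.

(** Polynomials in one variable over those in n variables map onto those in n + 1 variables, ['X]
    going to the last one. *)
Lemma ideals_fg_mpoly (F : fieldType) (n : nat) : ideals_fg (mpoly n F).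
Proof.
elim: n => [|n IHn].
  apply: (@ideals_fg_surj F _ (@mpolyC 0 F)); last exact: ideals_fg_field.
  apply: mpoly_ring_ind => [c|[]//|p q|p q]; first by exists c.
    by move=> [a <-] [b <-]; exists (a + b); rewrite rmorphD.
  by move=> [a <-] [b <-]; exists (a * b); rewrite rmorphM.
pose x : mpoly n.+1 F := mpolyX F (mnm1 ord_max).
pose w := @mwiden n F : {rmorphism mpoly n F -> mpoly n.+1 F}.
have cwx : commr_rmorph w x by move=> ?; exact: mulrC.
apply: (@ideals_fg_surj {poly mpoly n F} _ (horner_morph cwx)); last exact: ideals_fg_poly.
apply: mpoly_ring_ind => [c|i|p q|p q].
- by exists (mpolyC n c)%:P; rewrite /= horner_morphC /= mwidenC.
- have [j ->|->] := unliftP ord_max i; last by exists 'X; rewrite /= horner_morphX.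
  exists (mpolyX F (mnm1 j))%:P; rewrite /= horner_morphC /= mwidenX; congr mpolyX.
  by rewrite mnmwiden1; congr mnm1; apply: val_inj; rewrite /= /bump leqNgt ltn_ord.
- by move=> [a <-] [b <-]; exists (a + b); rewrite rmorphD.
- by move=> [a <-] [b <-]; exists (a * b); rewrite rmorphM.
Qed.

(** * Extension of derivations *)

Section Derivations.
Variable K : fieldType.
Implicit Types (S : subringClosed K) (D : K -> K) (P Q : {poly K}).

(** [D] is total but unconstrained outside [S], so that it can be extended one element at a time. *)
Definition derivation_on (S : {pred K}) D :=
  {in S &, forall a b, D (a + b) = D a + D b} /\
  {in S &, forall a b, D (a * b) = a * D b + D a * b}.

Definition adjoin (S : {pred K}) (b : K) : {pred K} :=
  fun a => `[< exists2 P, P \is a polyOver S & a = P.[b] >].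

Lemma adjoinP (S : {pred K}) b a :
  reflect (exists2 P, P \is a polyOver S & a = P.[b]) (a \in adjoin S b).
Proof. exact: asboolP. Qed.

Lemma adjoin_subring S b : subring_closed (adjoin S b).
Proof.
split.
- by apply/adjoinP; exists 1; rewrite ?rpred1 // hornerC.
- move=> _ _ /adjoinP[P SP ->] /adjoinP[Q SQ ->].
  by apply/adjoinP; exists (P - Q); rewrite ?rpredB // hornerD hornerN.
- move=> _ _ /adjoinP[P SP ->] /adjoinP[Q SQ ->].
  by apply/adjoinP; exists (P * Q); rewrite ?rpredM // hornerM.
Qed.

HB.instance Definition _ S b :=
  GRing.isSubringClosed.Build K (adjoin S b) (adjoin_subring S b).

Lemma sub_adjoin S b : {subset S <= adjoin S b}.
Proof. by move=> a Sa; apply/adjoinP; exists a%:P; rewrite ?polyOverC ?hornerC. Qed.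

Lemma mem_adjoin S b : b \in adjoin S b.
Proof. by apply/adjoinP; exists 'X; rewrite ?polyOverX ?hornerX. Qed.

Definition transcendental_over (S : {pred K}) (b : K) :=
  forall P, P \is a polyOver S -> P.[b] = 0 -> P = 0.

Lemma derivation_on0 S D : derivation_on S D -> D 0 = 0.
Proof.
move=> [DD _]; have := DD 0 0 (rpred0 S) (rpred0 S).
by rewrite addr0 => /eqP; rewrite -subr_eq subrr => /eqP.
Qed.

Lemma derivation_on_sum S D (J : Type) (r : seq J) (p : pred J) (F : J -> K) :
  derivation_on S D -> (forall j, p j -> F j \in S) ->
  D (\sum_(j <- r | p j) F j) = \sum_(j <- r | p j) D (F j).
Proof.
move=> dD SF; have [DD _] := dD.
suff [] : \sum_(j <- r | p j) F j \in S /\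
  D (\sum_(j <- r | p j) F j) = \sum_(j <- r | p j) D (F j) by [].
elim: r => [|j r [IHS IHD]].
  by rewrite !big_nil (derivation_on0 dD) rpred0.
rewrite !big_cons; case: ifP => // pj.
by rewrite rpredD ?SF // DD ?SF // IHD.
Qed.

Section Extend.
Variables (S : subringClosed K) (D : K -> K) (b : K).
Hypothesis dD : derivation_on S D.

(* The value at P(b) of the extension of D to S[b] mapping b to w *)
Let del (w : K) P := (map_poly D P).[b] + P^`().[b] * w.

Let cmD P i : (map_poly D P)`_i = D P`_i.
Proof. by rewrite coef_map_id0 // (derivation_on0 dD). Qed.

Let delD w P Q : P \is a polyOver S -> Q \is a polyOver S ->
  del w (P + Q) = del w P + del w Q.
Proof.
move=> /polyOverP SP /polyOverP SQ; rewrite /del derivD !hornerD.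
have -> : map_poly D (P + Q) = map_poly D P + map_poly D Q.
  by apply/polyP => i; rewrite coefD !cmD coefD; case: dD => + _; apply.
by rewrite hornerD mulrDl addrACA.
Qed.

Let delM w P Q : P \is a polyOver S -> Q \is a polyOver S ->
  del w (P * Q) = P.[b] * del w Q + del w P * Q.[b].
Proof.
move=> /polyOverP SP /polyOverP SQ; rewrite /del derivM !(hornerD, hornerM).
have -> : map_poly D (P * Q) = P * map_poly D Q + map_poly D P * Q.
  apply/polyP => i; rewrite cmD coefD !coefM (derivation_on_sum _ dD).
    rewrite -big_split; apply: eq_bigr => j _ /=.
    by rewrite !cmD; case: dD => _; apply.
  by move=> j _; rewrite rpredM.
by rewrite !(hornerD, hornerM); ring.
Qed.

Let mapC a : map_poly D a%:P = (D a)%:P.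
Proof.
apply/polyP => i; rewrite cmD !coefC.
by case: eqP; rewrite // (derivation_on0 dD).
Qed.

Let delC w a : a \in S -> del w a%:P = D a.
Proof.
move=> Sa; by rewrite /del derivC hornerC mul0r addr0 mapC hornerC.
Qed.

Let delX w : del w 'X = w.
Proof.
rewrite /del derivX hornerC mul1r.
have D1 : D 1 = 0.
  have [_ /(_ 1 1 (rpred1 S) (rpred1 S))] := dD.
  by rewrite !mul1r mulr1 => /eqP; rewrite -subr_eq subrr => /eqP.
suff -> : map_poly D 'X = 0 by rewrite horner0 add0r.
apply/polyP => i; rewrite cmD coefX coef0.
by case: eqP; rewrite ?D1 // (derivation_on0 dD).
Qed.

(** If [b] is transcendental, its image is free. Otherwise an equation [P] of least degree forces
    the image [v]: in characteristic zero the derivative of [P], being of smaller degree and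
    nonzero, does not vanish at [b]. *)
Lemma derivation_extend (w : K) : [pchar K] =i pred0 ->
  exists D', [/\ derivation_on (adjoin S b) D', {in S, D' =1 D}
    & transcendental_over S b -> D' b = w].
Proof.
move=> ch0.
have [v [v0 vw]] : exists v,
    (forall P, P \is a polyOver S -> P.[b] = 0 -> del v P = 0) /\
    (transcendental_over S b -> v = w).
  have [tb|ntb] := pselect (transcendental_over S b).
    exists w; split=> // P SP Pb; rewrite (tb P SP Pb) /del.
    by rewrite deriv0 !horner0 mul0r addr0 -[X in map_poly D X]/(0%:P) mapC hornerC
      (derivation_on0 dD).
  pose pr k := `[< exists P, [/\ P \is a polyOver S, P.[b] = 0, P != 0 & size P = k] >].
  have expr : exists k, pr k.
    move: ntb => /existsNP[P /not_implyP[SP /not_implyP[Pb /eqP P0]]].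
    by exists (size P); apply/asboolP; exists P.
  case: (ex_minnP expr) => k /asboolP[P [SP Pb P0 sP]] kmin.
  have kle Q : Q \is a polyOver S -> Q.[b] = 0 -> Q != 0 -> (k <= size Q)%N.
    by move=> SQ Qb Q0; apply: kmin; apply/asboolP; exists Q.
  have dP0 : P^`().[b] != 0.
    apply/eqP => dPb.
    have dP : P^`() != 0.
      case: (ltngtP 1%N (size P)) => [sP1|sP1|sP1].
      - apply/eqP => /(congr1 (fun q : {poly K} => q`_(size P).-2)).
        rewrite coef_deriv coef0 => /eqP.
        rewrite prednK; last by move: sP1; lia.
        rewrite -mulr_natr mulf_eq0 -/(lead_coef P) lead_coef_eq0 (negbTE P0) /=.
        rewrite (pcharf0P K).1 //.
        by move: sP1; case: (size P) => [|[|m]].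
      - by move: P0; rewrite -size_poly_gt0; move: sP1; lia.
      - have PE : P = (P`_0)%:P by apply: size1_polyC; rewrite -sP1.
        move: Pb P0; rewrite PE hornerC => ->.
        by rewrite eqxx.
    have := kle _ (polyOver_deriv SP) dPb dP.
    by rewrite -sP leqNgt lt_size_deriv.
  exists (- (map_poly D P).[b] / P^`().[b]); split; last first.
    by move/(_ P SP Pb)/eqP; rewrite (negbTE P0).
  set v := _ / _.
  have dlP : del v P = 0 by rewrite /del /v mulrC divfK // addrN.
  move=> Q SQ Qb; have [m] := ubnP (size Q); elim: m Q SQ Qb => // m IHm Q SQ Qb sQ.
  have [->|Q0] := eqVneq Q 0.
    by rewrite -[0]/(0%:P) delC ?rpred0 // (derivation_on0 dD).
  have kQ := kle Q SQ Qb Q0.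
  (* One step of pseudo-division of [Q] by [P]: [S] is only a ring, so [Q] is first multiplied by
     the leading coefficient of [P]. This multiplies [del v Q] by a nonzero factor. *)
  pose T := (lead_coef Q)%:P * 'X^(size Q - size P).
  pose Q1 := (lead_coef P)%:P * Q - T * P.
  have SlQ : lead_coef Q \in S by exact: (polyOverP SQ).
  have SlP : lead_coef P \in S by exact: (polyOverP SP).
  have ST : T \is a polyOver S by rewrite rpredM ?polyOverC // rpredX // polyOverX.
  have SQ1 : Q1 \is a polyOver S by rewrite rpredB // rpredM // polyOverC.
  have dQ1 : del v Q1 = lead_coef P * del v Q.
    have -> : del v Q1 = del v ((lead_coef P)%:P * Q) - del v (T * P).
      apply/eqP; rewrite eq_sym subr_eq -delD ?subrK //.
      by rewrite rpredM.
    rewrite delM ?polyOverC // delM // hornerC Qb Pb dlP; ring.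
  have : del v Q1 = 0.
    apply: IHm => //; first by rewrite /Q1 hornerD hornerN !hornerM Qb Pb; ring.
    have sQ0 : (0 < size Q)%N by rewrite size_poly_gt0.
    have sP0 : (0 < size P)%N by rewrite size_poly_gt0.
    suff : (size Q1 <= (size Q).-1)%N by move: sQ sQ0; lia.
    apply/leq_sizeP => j; rewrite leq_eqVlt => /orP[/eqP <-|jQ].
      rewrite coefB !coefCM -mulrA coefCM coefXnM ltnNge.
      rewrite (_ : (size Q - size P <= (size Q).-1)%N); last by move: sP0; lia.
      rewrite /= (_ : ((size Q).-1 - (size Q - size P))%N = (size P).-1).
        by rewrite -!/(lead_coef _) mulrC subrr.
      by move: sP0 kQ; rewrite -sP; lia.
    rewrite coefB coefCM -mulrA coefCM coefXnM [Q`_j]nth_default; last exact: leq_trans (leqSpred _) jQ.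
    case: ltnP => [_|le]; first by rewrite !mulr0 subrr.
    rewrite [P`__]nth_default ?mulr0 ?subrr // -(leq_add2r (size Q - size P)) subnK //.
    by rewrite addnC subnK ?sP //; exact: leq_trans (leqSpred _) jQ.
  by rewrite dQ1 => /eqP; rewrite mulf_eq0 lead_coef_eq0 (negbTE P0) => /eqP.
(* An arbitrary expression of [a] as a polynomial in [b]; by [v0] the value of [del v] does not
   depend on the choice. *)
pose rep a := xget 0 [set P | P \is a polyOver S /\ a = P.[b]].
have repP a : a \in adjoin S b -> rep a \is a polyOver S /\ a = (rep a).[b].
  move=> /adjoinP[P SP aE]; rewrite /rep.
  by case: xgetP => [Q _ []|/(_ P) []].
have delE P : P \is a polyOver S -> del v (rep P.[b]) = del v P.
  move=> SP; have [|SR RE] := repP P.[b]; first by apply/adjoinP; exists P.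
  apply/eqP; rewrite -subr_eq0; apply/eqP.
  have <- : del v (rep P.[b] - P) = del v (rep P.[b]) - del v P.
    by apply/eqP; rewrite eq_sym subr_eq -delD ?subrK ?rpredB.
  by apply: v0; rewrite ?rpredB // hornerD hornerN -RE subrr.
exists (fun a => del v (rep a)); split.
- split=> _ _ /adjoinP[P SP ->] /adjoinP[Q SQ ->].
    by rewrite -hornerD !delE ?rpredD // delD.
  by rewrite -hornerM !delE ?rpredM // delM.
- by move=> a Sa; rewrite -{1}(hornerC a b) delE ?polyOverC ?delC.
- by move=> tb; rewrite -{1}(hornerX b) delE ?polyOverX // delX vw.
Qed.

End Extend.

End Derivations.

(** Elements [x i] taken in [P i.+1] but not in [P i] are algebraically independent over the
    constants [C], so the values of a derivation on them can be prescribed. *)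
Lemma prime_chain_derivations (K : fieldType) (A : comNzRingType)
    (iota : {rmorphism A -> K}) (C : subringClosed K) (d : nat) :
  [pchar K] =i pred0 -> injective iota ->
  (forall c, c \in C -> exists a, iota a = c) ->
  (forall c, c \in C -> c != 0 -> exists a, iota a * c = 1) ->
  has_prime_chain A d ->
  exists x : nat -> A, forall w : nat -> K, exists (S : subringClosed K) D,
    [/\ derivation_on S D, {subset C <= S}, {in C, forall c, D c = 0}
      & forall i, (i < d)%N -> iota (x i) \in S /\ D (iota (x i)) = w i].
Proof.
move=> ch0 inj_iota CA Cunit [P Pchain].
have ex i : exists x, (i < d)%N -> x \in P i.+1 /\ x \notin P i.
  have [id|nid] := boolP (i < d)%N; last by exists 0.
  have [_ /existsNP[x /not_implyP[xP /negP nxP]]] := Pchain i id.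
  by exists x.
have [x xP] := choice ex; exists x.
(* Downwards along the chain: [S], obtained from [C] by adjoining [x i] for i from d - 1 down to d -
   k, meets [P (d - k)] only in 0. *)
suff H k : (k <= d)%N -> exists S : subringClosed K,
  [/\ forall c, c \in S -> exists a, iota a = c,
      forall a, iota a \in S -> a \in P (d - k)%N -> a = 0,
      {subset C <= S}
    & forall w : nat -> K, exists D,
    [/\ derivation_on S D, {in C, forall c, D c = 0}
      & forall i, (d - k <= i < d)%N -> iota (x i) \in S /\ D (iota (x i)) = w i]].
  have [S [_ _ CS SD]] := H d (leqnn d).
  move=> w; have [D [dD D0 Dx]] := SD w; exists S, D; split=> // i id.
  by apply: Dx; rewrite subnn.
elim: k => [|k IHk] kd.
  rewrite subn0; exists C; split=> [//|a aC aP|//|w].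
    apply/eqP/negPn/negP => a0.
    have [|b ba] := Cunit _ aC.
      by apply: contra_neq a0 => a0; apply: inj_iota; rewrite a0 rmorph0.
    suff: 1 \in P d by rewrite idealr1.
    have <- : b * a = 1 by apply: inj_iota; rewrite rmorphM rmorph1.
    by rewrite idealMr.
  exists (fun=> 0); split=> //.
    by split=> a b _ _; rewrite ?addr0 ?mulr0 ?mul0r ?addr0.
  by move=> i; case: ltngtP.
have [S [SA SP CS SD]] := IHk (ltnW kd).
set j := (d - k.+1)%N; have jd : (j < d)%N by rewrite /j; lia.
have jE : (d - k)%N = j.+1 by rewrite /j; lia.
rewrite jE in SP SD.
have [xj nxj] := xP j jd.
have [sPj _] := Pchain j jd.
have polyA Q : Q \is a polyOver S -> exists a, iota a = Q.[iota (x j)].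
  elim/poly_ind: Q => [_|Q c IHQ SQ]; first by exists 0; rewrite horner0 rmorph0.
  have [c' c'E] : exists a, iota a = c.
    by apply: SA; have := polyOverP SQ 0; rewrite coefD coefMX coefC eqxx add0r.
  have [|q qE] := IHQ.
    apply/polyOverP => i; have := polyOverP SQ i.+1.
    by rewrite coefD coefMX coefC /= addr0.
  by exists (q * x j + c'); rewrite rmorphD rmorphM hornerMXaddC qE c'E.
(* Modulo [P j.+1], which contains [x j], only the constant coefficient of the polynomial remains,
   and it is 0 by [SP]. Since [x j] is not in the prime [P j], it can be cancelled, which lowers the
   degree. *)
have key Q : Q \is a polyOver S -> forall e, iota e = Q.[iota (x j)] -> e \in P j -> Q = 0.
  elim/poly_ind: Q => [//|Q c IHQ SQ e eE eP].
  have Sc : c \in S.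
    by have := polyOverP SQ 0; rewrite coefD coefMX coefC eqxx add0r.
  have SQ1 : Q \is a polyOver S.
    apply/polyOverP => i; have := polyOverP SQ i.+1.
    by rewrite coefD coefMX coefC /= addr0.
  have [c' c'E] := SA _ Sc; have [q qE] := polyA _ SQ1.
  have eE' : e = q * x j + c'.
    by apply: inj_iota; rewrite eE rmorphD rmorphM hornerMXaddC qE c'E.
  have c'0 : c' = 0.
    apply: SP; first by rewrite c'E.
    have -> : c' = e - q * x j by rewrite eE' addrAC subrr add0r.
    by rewrite rpredB ?idealMr // sPj.
  have /orP[qP|] : (q \in P j) || (x j \in P j).
    by rewrite -prime_idealrM // -[_ * _]addr0 -c'0 -eE'.
    by rewrite (IHQ SQ1 q) // mul0r add0r -c'E c'0 rmorph0.
  by rewrite (negbTE nxj).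
have tr : transcendental_over S (iota (x j)).
  by move=> Q SQ Q0; apply: (key _ SQ 0); rewrite ?rmorph0 // rpred0.
exists (adjoin S (iota (x j)) : subringClosed K); split.
- by move=> c /adjoinP[Q SQ ->]; exact: polyA.
- move=> a /adjoinP[Q SQ aE] aP; apply: inj_iota.
  by rewrite aE (key Q SQ a) // horner0 rmorph0.
- by move=> c /CS; exact: sub_adjoin.
move=> w; have [D [dD D0 Dx]] := SD w.
have [D' [dD' D'D D'x]] := derivation_extend (iota (x j)) dD (w j) ch0.
exists D'; split=> //.
  by move=> c cC; rewrite D'D ?D0 // CS.
move=> i /andP[]; rewrite leq_eqVlt => /orP[/eqP <- _|ji id].
  by split; [exact: mem_adjoin|exact: D'x].
have [|xS <-] := Dx i; first by rewrite ji.
by split; [exact: sub_adjoin|exact: D'D].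
Qed.

Lemma mderiv_var (A : nzRingType) (n : nat) (i j : 'I_n) :
  mderiv i (mpolyX A (mnm1 j)) = (i == j)%:R.
Proof.
rewrite mderivX mnm1E eq_sym; case: eqP => [->|_]; last by rewrite scale0r.
rewrite scale1r (_ : mnm_sub _ _ = mnm0) ?mpolyX0 //.
by apply/mnmP => k; rewrite !mnmE subnn.
Qed.

Section MpolyDerivation.
Variables (F : fieldType) (n : nat) (K : fieldType).
Variable phi : {rmorphism mpoly n F -> K}.

Lemma derivation_mpoly (S : subringClosed K) (D : K -> K) :
  derivation_on S D -> (forall c, phi (mpolyC n c) \in S) ->
  (forall c, D (phi (mpolyC n c)) = 0) ->
  (forall i, phi (mpolyX F (mnm1 i)) \in S) ->
  forall p, phi p \in S /\
    D (phi p) = \sum_i D (phi (mpolyX F (mnm1 i))) * phi (mderiv i p).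
Proof.
move=> dD SC DC SX; have [DD DM] := dD; apply: mpoly_ring_ind.
- by move=> c; rewrite SC DC big1 // => i _; rewrite mderivC rmorph0 mulr0.
- move=> i; rewrite SX; split=> //; rewrite (bigD1 i) //= mderiv_var eqxx.
  rewrite rmorph1 mulr1 big1 ?addr0 // => j ji.
  by rewrite mderiv_var (negbTE ji) rmorph0 mulr0.
- move=> p q [Sp Dp] [Sq Dq]; rewrite rmorphD rpredD // DD // Dp Dq; split=> //.
  by rewrite -big_split; apply: eq_bigr => i _; rewrite /= mderivD rmorphD mulrDr.
- move=> p q [Sp Dp] [Sq Dq]; rewrite rmorphM rpredM // DM // Dp Dq; split=> //.
  rewrite mulr_sumr mulr_suml -big_split; apply: eq_bigr => i _ /=.
  by rewrite mderivM rmorphD !rmorphM; ring.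
Qed.

Lemma derivation_extend_mpoly (S : subringClosed K) (D : K -> K) :
  [pchar K] =i pred0 -> derivation_on S D ->
  (forall c, phi (mpolyC n c) \in S) ->
  exists (S' : subringClosed K) D', [/\ derivation_on S' D', {subset S <= S'},
    {in S, D' =1 D} & forall i, phi (mpolyX F (mnm1 i)) \in S'].
Proof.
move=> ch0 dD SC.
suff H (s : seq K) : exists (S' : subringClosed K) D', [/\ derivation_on S' D',
    {subset S <= S'}, {in S, D' =1 D} & {subset s <= S'}].
  have [S' [D' [dD' SS' D'D S's]]] := H [seq phi (mpolyX F (mnm1 i)) | i <- enum 'I_n].
  exists S', D'; split=> // i; apply: S's.
  by apply/mapP; exists i; first rewrite mem_enum.
elim: s => [|b s [S' [D' [dD' SS' D'D S's]]]]; first by exists S, D; split.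
have [D'' [dD'' DD'' _]] := derivation_extend b dD' 0 ch0.
exists (adjoin S' b : subringClosed K), D''; split=> //.
- by move=> a /SS'; exact: sub_adjoin.
- by move=> a aS; rewrite DD'' ?D'D // SS'.
- move=> a; rewrite inE => /orP[/eqP ->|/S's]; [exact: mem_adjoin|exact: sub_adjoin].
Qed.

End MpolyDerivation.

(** * The local ring at a point *)

Section Restriction.
Variables (R : realType) (n : nat) (X : irrAlgSet R n).
Local Notation poly := (mpoly n R).
Local Notation K := (rat_field X).
Local Notation var i := (mpolyX R (mnm1 i) : poly).

Definition restr (p : poly) : K := FracField.tofrac (polyfun X p).

Lemma restr_zmod_morphism : zmod_morphism restr.
Proof. by move=> p q; rewrite /restr polyfunB tofracB. Qed.

Lemma restr_monoid_morphism : monoid_morphism restr.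
Proof.
split; first by rewrite /restr polyfun1 tofrac1.
by move=> p q; rewrite /restr polyfunM tofracM.
Qed.

HB.instance Definition _ :=
  GRing.isZmodMorphism.Build poly K restr restr_zmod_morphism.
HB.instance Definition _ :=
  GRing.isMonoidMorphism.Build poly K restr restr_monoid_morphism.

Lemma restr0 : restr 0 = 0. Proof. exact: rmorph0. Qed.
Lemma restr1 : restr 1 = 1. Proof. exact: rmorph1. Qed.
Lemma restrD p q : restr (p + q) = restr p + restr q. Proof. exact: rmorphD. Qed.
Lemma restrB p q : restr (p - q) = restr p - restr q. Proof. exact: rmorphB. Qed.
Lemma restrM p q : restr (p * q) = restr p * restr q. Proof. exact: rmorphM. Qed.

Lemma restr_sum (J : Type) (r : seq J) (P : pred J) (F : J -> poly) :
  restr (\sum_(j <- r | P j) F j) = \sum_(j <- r | P j) restr (F j).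
Proof. exact: rmorph_sum. Qed.

Lemma restr_eq0 p : restr p = 0 <-> forall y, irr_set X y -> pval p y = 0.
Proof.
split=> [/eqP|p0]; first by rewrite tofrac_eq0 polyfun_eq0 => /asboolP.
by apply/eqP; rewrite tofrac_eq0 polyfun_eq0; apply/asboolP.
Qed.

Lemma restr_eq p q : restr p = restr q <-> forall y, irr_set X y -> pval p y = pval q y.
Proof.
split=> [/eqP|pq].
  rewrite -subr_eq0 -restrB => /eqP /restr_eq0 pq y Xy.
  by apply/eqP; rewrite -subr_eq0 -pvalB pq.
by congr FracField.tofrac; apply/polyfunP.
Qed.

Lemma restr_neq0 p y : irr_set X y -> pval p y != 0 -> restr p != 0.
Proof. by move=> Xy; apply: contra_neq => /restr_eq0; apply. Qed.

Lemma pvalC c y : pval (mpolyC n c : poly) y = c.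
Proof. exact: mevalC. Qed.

Lemma pvalX i y : pval (var i) y = y ord0 i.
Proof. exact: mevalXU. Qed.

Lemma pval_sum (J : Type) (r : seq J) (P : pred J) (F : J -> poly) y :
  pval (\sum_(j <- r | P j) F j) y = \sum_(j <- r | P j) pval (F j) y.
Proof. exact: rmorph_sum. Qed.

Lemma pval_prod (J : Type) (r : seq J) (P : pred J) (F : J -> poly) y :
  pval (\prod_(j <- r | P j) F j) y = \prod_(j <- r | P j) pval (F j) y.
Proof. exact: rmorph_prod. Qed.

Lemma pchar_rat_field : [pchar K] =i pred0.
Proof.
apply/pcharf0P => k; have [[y Xy] _] := irr_set_irreducible X.
apply/eqP/eqP => [|-> //]; rewrite -(rmorph_nat restr) => /restr_eq0 /(_ y Xy).
rewrite (_ : pval _ y = k%:R); last exact: rmorph_nat (meval _) _.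
by move/eqP; rewrite pnatr_eq0 => /eqP.
Qed.

Definition const_field : {pred K} := fun g => `[< exists c, restr (mpolyC n c) = g >].

Lemma const_fieldP g : reflect (exists c, restr (mpolyC n c) = g) (g \in const_field).
Proof. exact: asboolP. Qed.

Lemma const_field_subring : subring_closed const_field.
Proof.
split.
- by apply/const_fieldP; exists 1; rewrite !rmorph1.
- move=> _ _ /const_fieldP[a <-] /const_fieldP[b <-].
  by apply/const_fieldP; exists (a - b); rewrite !rmorphB.
- move=> _ _ /const_fieldP[a <-] /const_fieldP[b <-].
  by apply/const_fieldP; exists (a * b); rewrite !rmorphM.
Qed.

HB.instance Definition _ :=
  GRing.isSubringClosed.Build K const_field const_field_subring.

Section Point.
Variable x : X.
Local Notation O := (local_ring x).
Local Notation x0 := (val x).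

Lemma irr_set_val : irr_set X x0. Proof. exact/set_mem/(valP x). Qed.
Hint Resolve irr_set_val : core.

Lemma local_valD (g h : O) : local_val (g + h) = local_val g + local_val h :> K.
Proof. by []. Qed.

Lemma local_valM (g h : O) : local_val (g * h) = local_val g * local_val h :> K.
Proof. by []. Qed.

Lemma local_val1 : local_val (1 : O) = 1 :> K. Proof. by []. Qed.

Lemma local_val_sum (J : Type) (r : seq J) (P : pred J) (F : J -> O) :
  local_val (\sum_(j <- r | P j) F j) = \sum_(j <- r | P j) local_val (F j) :> K.
Proof. exact: (rmorph_sum (val : {rmorphism O -> K})). Qed.

Lemma local_ringP (g : O) :
  exists a b : poly, pval b x0 != 0 /\ local_val g * restr b = restr a.
Proof.
have /asboolP[a [b [b0 gE]]] := local_valP g.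
exists (repr a), (repr b); split=> //.
rewrite /restr !polyfun_repr [local_val g]gE divfK // tofrac_eq0.
apply: contraNneq b0 => ->.
by rewrite -polyfun0 coord_val_polyfun ?pval0.
Qed.

Lemma local_ring_fraction (a b : poly) : pval b x0 != 0 ->
  exists g : O, local_val g * restr b = restr a.
Proof.
move=> b0; have rg : regular_at x (restr a / restr b).
  apply/asboolP; exists (polyfun X a), (polyfun X b); split=> //.
  by rewrite coord_val_polyfun.
by exists (LocalRing rg); rewrite /= divfK // (restr_neq0 irr_set_val b0).
Qed.

Definition vanishing_at : {pred O} := fun g => `[< exists a b : poly,
  [/\ pval b x0 != 0, local_val g * restr b = restr a & pval a x0 = 0] >].

Lemma vanishing_atP g : reflect (exists a b : poly,
  [/\ pval b x0 != 0, local_val g * restr b = restr a & pval a x0 = 0])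
  (g \in vanishing_at).
Proof. exact: asboolP. Qed.

Lemma vanishing_at_closed : idealr_closed vanishing_at.
Proof.
split.
- by apply/vanishing_atP; exists 0, 1; rewrite pval1 pval0 oner_neq0 restr0 restr1 mulr1.
- apply/negP => /vanishing_atP[a [b [b0]]].
  rewrite local_val1 mul1r => /restr_eq/(_ _ irr_set_val) ab a0.
  by move: b0; rewrite ab a0 eqxx.
- move=> c g h /vanishing_atP[a [b [b0 gE a0]]] /vanishing_atP[a' [b' [b0' hE a0']]].
  have [e [f [f0 cE]]] := local_ringP c.
  apply/vanishing_atP; exists (e * a * b' + a' * (f * b)), (f * b * b'); split.
  + by rewrite !pvalM !mulf_neq0.
  + by rewrite local_valD local_valM restrD !restrM -cE -gE -hE; ring.
  + by rewrite pvalD !pvalM a0 a0' mulr0 !mul0r addr0.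
Qed.

HB.instance Definition _ := isIdealr.Build O vanishing_at vanishing_at_closed.

Lemma vanishing_at_maximal : maximal_ideal (vanishing_at : idealr O).
Proof.
move=> I MI g Ig; have [a [b [b0 gE]]] := local_ringP g.
apply/vanishing_atP; exists a, b; split=> //; apply/eqP/negPn/negP => a0.
have [g' g'E] := local_ring_fraction b a0.
suff: 1 \in I by rewrite idealr1.
have <- : g' * g = 1.
  apply: val_inj; rewrite -[LHS]/(local_val (g' * g)) -[RHS]/(local_val (1 : O)).
  rewrite local_valM local_val1.
  have ra := restr_neq0 irr_set_val a0; apply: (mulIf ra).
  have rb := restr_neq0 irr_set_val b0; apply: (mulIf rb).
  by rewrite mul1r -{2}g'E -gE; ring.
by rewrite idealMr.
Qed.

(** The chain gives germs [g j] and derivations dual to them. The rows of [T] are the values of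
    these derivations on the coordinates; by the chain rule they annihilate the gradient of every
    equation of X. *)
Lemma chain_tangent (d : nat) : has_prime_chain O d ->
  exists2 T : 'M[K]_(d, n), \rank T = d
  & forall h, restr h = 0 -> T *m (\col_i restr (mderiv i h)) = 0.
Proof.
move=> chain.
have [||g gP] := @prime_chain_derivations K O val const_field d pchar_rat_field
  val_inj _ _ chain.
- move=> _ /const_fieldP[c <-].
  have [g gE] := @local_ring_fraction (mpolyC n c) 1 (ltac:(by rewrite pval1 oner_neq0)).
  by exists g; rewrite -gE restr1 mulr1.
- move=> _ /const_fieldP[c <-] c0.
  have c1 : c != 0 by apply: contra_neq c0 => ->; rewrite !rmorph0.
  have [g gE] := @local_ring_fraction 1 (mpolyC n c) (ltac:(by rewrite pvalC)).
  by exists g; rewrite gE restr1.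
(* The second clause is the Leibniz rule for [g j] times b equal to a: it expresses that the
   derivation sends [g j] to [(k == j)%:R]. *)
have exT k : exists v : 'rV[K]_n,
    (forall h, restr h = 0 -> v *m (\col_i restr (mderiv i h)) = 0) /\
    forall j, (j < d)%N -> forall a b, local_val (g j) * restr b = restr a ->
      (v *m (\col_i (restr (mderiv i a) - local_val (g j) * restr (mderiv i b)))) 0 0
        = (k == j)%:R * restr b.
  have [S [D [dD CS D0 Dg]]] := gP (fun j => (k == j)%:R).
  have SC c : restr (mpolyC n c) \in S by apply: CS; apply/const_fieldP; exists c.
  have [S' [D' [dD' SS' D'D SX]]] := derivation_extend_mpoly pchar_rat_field dD SC.
  have DC c : D' (restr (mpolyC n c)) = 0.
    by rewrite (D'D _ (SC c)); apply: D0; apply/const_fieldP; exists c.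
  have DE p : restr p \in S' /\
      D' (restr p) = \sum_i D' (restr (var i)) * restr (mderiv i p).
    exact: (derivation_mpoly dD' (fun c => SS' _ (SC c)) DC SX).
  exists (\row_i D' (restr (var i))); split=> [h h0|j jd a b gE].
    apply/matrixP => i l; rewrite !ord1 !mxE.
    under eq_bigr do rewrite !mxE.
    by rewrite -(DE h).2 h0 (derivation_on0 dD').
  have [Sg Dgj] := Dg j jd; have [_ DM] := dD'.
  have Dgj' : D' (local_val (g j)) = (k == j)%:R := etrans (D'D _ Sg) Dgj.
  have := congr1 D' gE; rewrite (DM _ _ (SS' _ Sg) (DE b).1) Dgj' !(DE _).2.
  move=> E; rewrite !mxE; under eq_bigr do rewrite !mxE mulrBr.
  rewrite sumrB -E; under [X in _ - X]eq_bigr do rewrite mulrCA.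
  by rewrite -mulr_sumr addrAC subrr add0r.
have [v vP] := choice exT.
pose T := \matrix_(k < d, i < n) v k 0 i.
have rowT k : row k T = v k by apply/matrixP => i j; rewrite !mxE ord1.
exists T; last first.
  move=> h h0; apply/row_matrixP => k; rewrite row_mul rowT row0.
  by have [-> ] := vP k.
have exab j : exists ab : poly * poly,
    pval ab.2 x0 != 0 /\ local_val (g j) * restr ab.2 = restr ab.1.
  by have [a [b [b0 gE]]] := local_ringP (g j); exists (a, b).
have [ab abP] := choice exab.
pose Z := \matrix_(i < n, j < d)
  (restr (mderiv i (ab j).1) - local_val (g j) * restr (mderiv i (ab j).2)).
(* Up to nonzero denominators, the columns of [Z] are the gradients of the [g j]; the product is
   diagonal and invertible, so [T] has full rank. *)
have TZ : T *m Z = diag_mx (\row_j restr (ab j).2).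
  apply/matrixP => k j; rewrite !mxE.
  have [_ /(_ j (ltn_ord j) _ _ (abP j).2)] := vP k.
  rewrite !mxE => E; transitivity ((k == j :> nat)%:R * restr (ab j).2).
    by rewrite -E; apply: eq_bigr => i _; rewrite !mxE.
  have [->|kj] := eqVneq k j; rewrite ?eqxx ?mul1r //.
  by rewrite (negbTE (kj : (k : nat) != j)) mul0r.
have uTZ : T *m Z \in unitmx.
  rewrite TZ unitmxE det_diag unitfE; apply/prodf_neq0 => j _; rewrite mxE.
  exact: restr_neq0 irr_set_val (abP j).1.
apply/eqP; rewrite eqn_leq rank_leq_row /=.
by rewrite -{1}(mxrank_unit uTZ) mxrankM_maxl.
Qed.

(* The matrix 1 - A *m C has rank at least n - d. *)
Lemma generators_cotangent (d : nat) (s : seq O) : size s = d ->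
  [set g | g \in vanishing_at] = generated_by s ->
  exists (h : 'I_n -> poly) (A : 'M[R]_(n, d)) (C : 'M[R]_(d, n)),
    (forall j, restr (h j) = 0) /\
    \matrix_(i, j) pval (mderiv i (h j)) x0 = 1%:M - A *m C.
Proof.
move=> sd sE.
have exs k : exists ab : poly * poly, (k < d)%N ->
    [/\ pval ab.2 x0 != 0, local_val s`_k * restr ab.2 = restr ab.1 & pval ab.1 x0 = 0].
  have [kd|nkd] := boolP (k < d)%N; last by exists 0.
  suff /vanishing_atP[a [b abP]] : s`_k \in vanishing_at by exists (a, b).
  suff: [set g | g \in vanishing_at] s`_k by [].
  by rewrite sE; apply: mem_generated_by; rewrite mem_nth ?sd.
have [ab abP] := choice exs.
have exh j : exists h : poly * ('I_d -> R), restr h.1 = 0 /\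
    forall i, pval (mderiv i h.1) x0 =
      (i == j)%:R - \sum_(k < d) pval (mderiv i (ab k).1) x0 * h.2 k.
  have [t tE] := @local_ring_fraction (var j - mpolyC n (x0 ord0 j)) 1
    (ltac:(by rewrite pval1 oner_neq0)).
  have : generated_by s t.
    rewrite -sE; apply/vanishing_atP; do 2 eexists; split; last 2 first.
    - exact: tE.
    - by rewrite pvalB pvalX pvalC subrr.
    - by rewrite pval1 oner_neq0.
  rewrite restr1 mulr1 in tE.
  case; rewrite sd => c cE.
  have exc k : exists ef : poly * poly,
      pval ef.2 x0 != 0 /\ local_val (c k) * restr ef.2 = restr ef.1.
    by have [a [b [b0 gE]]] := local_ringP (c k); exists (a, b).
  have [ef efP] := choice exc.
  (* Multiplying the expression of [t] in the generators by the common denominator [E] gives an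
     equation of X. Divided by the value of [E] at [x0], its differential there is dx_j minus a
     combination of those of the numerators [(ab k).1], since these vanish at [x0]. *)
  pose E : poly := \prod_(k < d) ((ab k).2 * (ef k).2).
  pose B k : poly := \prod_(l < d | l != k) ((ab l).2 * (ef l).2) * (ef k).1.
  have E0 : pval E x0 != 0.
    rewrite pval_prod; apply/prodf_neq0 => k _; rewrite pvalM mulf_neq0 //.
      by case: (abP k (ltn_ord k)).
    by case: (efP k).
  pose e := (pval E x0)^-1.
  exists (mpolyC n e * (E * (var j - mpolyC n (x0 ord0 j)) - \sum_(k < d) B k * (ab k).1),
          fun k => e * pval (B k) x0); split=> [|i] /=.
    rewrite restrM restrB restrM -[restr (var j - _)]tE cE local_val_sum restr_sum mulr_sumr.
    rewrite -sumrB big1 ?mulr0 // => k _; rewrite local_valM restrM.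
    rewrite /E (bigD1 k) //= /B !restrM.
    have [_ <- _] := abP k (ltn_ord k); have [_ <-] := efP k.
    ring.
  rewrite mderivM mderivC mul0r add0r pvalM pvalC mderivB pvalB mderivM mderivB.
  rewrite mderiv_var mderivC subr0 pvalD !pvalM pvalB pvalX pvalC subrr mulr0 add0r.
  rewrite mulrBr mulrA /e mulVf // mul1r; congr (_ - _).
    by case: eqVneq => _; rewrite ?pval1 ?pval0.
  rewrite raddf_sum pval_sum mulr_sumr; apply: eq_bigr => k _.
  rewrite -[X in _ * pval X _ = _]/(mderiv i (B k * (ab k).1)) mderivM pvalD !pvalM.
  have [_ _ ->] := abP k (ltn_ord k).
  by rewrite mulr0 add0r; ring.
have [h hP] := choice exh.
exists (fun j => (h j).1), (\matrix_(i, k) pval (mderiv i (ab k).1) x0).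
exists (\matrix_(k, j) (h j).2 k); split=> [j|]; first by have [] := hP j.
apply/matrixP => i j; rewrite !mxE; have [_ ->] := hP j.
by congr (_ - _); apply: eq_bigr => k _; rewrite !mxE.
Qed.

End Point.
End Restriction.

(** * Equations adapted to the tangent space *)

Section Frames.
Variables (R : realType) (n : nat) (X : irrAlgSet R n).
Local Notation poly := (mpoly n R).
Local Notation K := (rat_field X).
Local Notation var i := (mpolyX R (mnm1 i) : poly).
Local Notation rmx := (map_mx (@restr R n X)).
Local Notation cmx := (map_mx (@mpolyC n R)).

Definition grad (h : poly) : 'cV[poly]_n := \col_i mderiv i h.

Definition jac (f : 'I_n -> poly) : 'M[poly]_n := \matrix_(i, j) mderiv i (f j).

Definition evalmx p q (A : 'M[poly]_(p, q)) (y : 'rV[R]_n) : 'M[R]_(p, q) :=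
  map_mx (fun a => pval a y) A.

(* A local system of equations H of X at x0 whose differential at x0 is a
   projector, with Pi the projector onto the tangent space along its range. *)
Record local_frame (x0 : 'rV[R]_n) (H : 'I_n -> poly) (Pi : 'M[R]_n) : Prop := {
  frame_restr : forall j, restr X (H j) = 0;
  frame_jac : evalmx (jac H) x0 = 1%:M - Pi;
  frame_idem : Pi *m Pi = Pi;
  frame_eq : (\row_j H j) *m cmx Pi = 0;
  frame_tangent : forall v : 'rV[K]_n, v *m rmx (jac H) = 0 ->
    forall h, restr X h = 0 -> v *m rmx (grad h) = 0 }.

Lemma evalmxM p q r (A : 'M[poly]_(p, q)) (B : 'M[poly]_(q, r)) y :
  evalmx (A *m B) y = evalmx A y *m evalmx B y.
Proof. exact: (map_mxM (meval (y ord0))). Qed.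

Lemma evalmxD p q (A B : 'M[poly]_(p, q)) y :
  evalmx (A + B) y = evalmx A y + evalmx B y.
Proof. exact: (map_mxD (meval (y ord0))). Qed.

Lemma evalmx_const p q (A : 'M[R]_(p, q)) y : evalmx (cmx A) y = A.
Proof. by apply/matrixP => i j; rewrite !mxE pvalC. Qed.

Lemma evalmx_det (A : 'M[poly]_n) y : \det (evalmx A y) = pval (\det A) y.
Proof. exact: (det_map_mx (meval (y ord0))). Qed.

Lemma evalmx_adj (A : 'M[poly]_n) y : \adj (evalmx A y) = evalmx (\adj A) y.
Proof. exact/esym/(map_mx_adj (meval (y ord0))). Qed.

(** Column operations turn [N], of rank at least n - d, into a projector. The Jacobian of the new
    equations [H] has generic rank at least n - d, so its left kernel has dimension at most d and is
    the row space of [T], which annihilates the gradients of all equations of X. *)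
Lemma exists_local_frame (x : X) : regular_local_ring (local_ring x) ->
  exists H Pi, local_frame (val x) H Pi.
Proof.
move=> [_ [M [maxM uniM [d [[chain _] [s sd sE]]]]]].
have {}sE : [set g | g \in vanishing_at (x := x)] = generated_by s.
  by rewrite -sE; apply/seteqP; split=> g /=; rewrite (uniM _ (@vanishing_at_maximal _ _ _ x)).
have [T rkT T0] := chain_tangent chain.
have [h [A [C [h0 hE]]]] := generators_cotangent sd sE.
pose N := 1%:M - A *m C; pose r := \rank N.
have rn : (r <= n)%N := rank_leq_row N.
have nrd : (n - r <= d)%N.
  rewrite leq_subLR; have : (\rank (1%:M : 'M[R]_n) <= \rank N + \rank (A *m C))%N.
    by rewrite -{1}(subrK (A *m C) 1%:M) mxrank_add.
  rewrite mxrank1 => /leq_trans; apply; rewrite leq_add2l.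
  exact: leq_trans (mxrankM_maxl _ _) (rank_leq_col _).
(* [E] is a projector with the column space of [N], and [Pi] is the complementary one. *)
pose L := col_ebase N; pose E := L *m pid_mx r *m invmx L.
pose Pi := L *m copid_mx r *m invmx L.
have uL : L \in unitmx := col_ebase_unit N.
have EPi : E = 1%:M - Pi.
  by rewrite /E /Pi /copid_mx mulmxBr mulmxBl mulmx1 mulmxV // opprB addrC subrK.
have PiPi : Pi *m Pi = Pi.
  by rewrite /Pi !mulmxA mulmxKV // -(mulmxA L) copid_mx_id.
have rkPi : (\rank Pi <= d)%N.
  apply: leq_trans (mxrankM_maxl _ _) _; apply: leq_trans (mxrankM_maxr _ _) _.
  by rewrite rank_copid_mx.
(* The final factor [E] leaves [N *m U] equal to [E] and makes [U *m Pi] zero, so that [frame_eq] is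
   an identity of polynomials, not only of differentials at the point. *)
pose U := invmx (row_ebase N) *m invmx L *m E.
have NU : N *m U = 1%:M - Pi.
  rewrite /U -{1}(mulmx_ebase N) -/L -/r !mulmxA mulmxK ?row_ebase_unit //.
  by rewrite mulmxKV // -(mulmxA L) pid_mx_id.
have UPi : U *m Pi = 0.
  by rewrite /U -mulmxA EPi mulmxBl mul1mx PiPi subrr mulmx0.
pose H j : poly := ((\row_l h l) *m cmx U) 0 j.
have HE : \row_j H j = (\row_l h l) *m cmx U.
  by apply/rowP => j; rewrite mxE.
have jacH : jac H = jac h *m cmx U.
  apply/matrixP => i j; rewrite !mxE /H mxE raddf_sum; apply: eq_bigr => l _.
  by rewrite /= !mxE mulrC mderiv_mulC mulrC.
have H0 j : restr X (H j) = 0.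
  by rewrite /H mxE restr_sum big1 // => l _; rewrite !mxE restrM h0 mul0r.
exists H, Pi; split=> //.
- rewrite jacH evalmxM evalmx_const -NU; congr (_ *m _); rewrite /N -hE.
  by apply/matrixP => i j; rewrite !mxE.
- by rewrite HE -mulmxA -map_mxM UPi map_mx0 mulmx0.
move=> v vH g g0.
have jacPsi : rmx (jac H + cmx Pi) \in unitmx.
  rewrite unitmxE unitfE det_map_mx; apply: (restr_neq0 (irr_set_val x)).
  rewrite -evalmx_det evalmxD evalmx_const jacH evalmxM evalmx_const.
  have -> : evalmx (jac h) (val x) = N.
    by rewrite /N -hE; apply/matrixP => i j; rewrite !mxE.
  by rewrite NU subrK det1 oner_neq0.
have rkH : (n - d <= \rank (rmx (jac H)))%N.
  rewrite leq_subLR -{1}(mxrank_unit jacPsi) map_mxD.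
  apply: leq_trans (mxrank_add _ _) _; rewrite addnC leq_add2r.
  rewrite -map_mx_comp; apply: leq_trans rkPi.
  have := mxrank_map (@restr R n X \o @mpolyC n R : {rmorphism R -> K}) Pi.
  by move=> <-.
have TK : (T <= kermx (rmx (jac H)))%MS.
  apply/sub_kermxP/matrixP => k j; have /matrixP/(_ k 0) := T0 _ (H0 j).
  by rewrite !mxE => E0; rewrite -[RHS]E0; apply: eq_bigr => i _; rewrite !mxE.
have KT : (kermx (rmx (jac H)) <= T)%MS.
  rewrite -(mxrank_leqif_sup TK) eqn_leq mxrankS // rkT mxrank_ker.
  by rewrite leq_subLR addnC -leq_subLR.
have /submxP[u ->] : (v <= T)%MS by apply: submx_trans KT; apply/sub_kermxP.
rewrite -mulmxA; have -> : rmx (grad g) = \col_i restr X (mderiv i g).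
  by apply/matrixP => i j; rewrite !mxE.
by rewrite T0 ?mulmx0.
Qed.

Section Frame.
Variables (x : X) (H : 'I_n -> poly) (Pi : 'M[R]_n).
Local Notation x0 := (val x).
Hypothesis fr : local_frame x0 H Pi.

(** The chart y -> [H] (y) + y [Pi]: its differential at [x0] is the identity, and on X it reduces
    to y [Pi]. *)
Definition frame_map (j : 'I_n) : poly := H j + \sum_i var i * mpolyC n (Pi i j).

Lemma mderiv_linear_form (a : 'I_n -> R) i :
  mderiv i (\sum_k var k * mpolyC n (a k)) = mpolyC n (a i).
Proof.
rewrite raddf_sum (bigD1 i) //= mderivM mderiv_var mderivC eqxx mulr0 addr0 mul1r.
rewrite big1 ?addr0 //= => k ki.
by rewrite mderivM mderiv_var mderivC mulr0 addr0 eq_sym (negbTE ki) mul0r.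
Qed.

Lemma jac_frame_map : jac frame_map = jac H + cmx Pi.
Proof. by apply/matrixP => i j; rewrite !mxE mderivD mderiv_linear_form. Qed.

Lemma jac_frame_map_x0 : evalmx (jac frame_map) x0 = 1%:M.
Proof. by rewrite jac_frame_map evalmxD evalmx_const (frame_jac fr) subrK. Qed.

Lemma frame_map_unit : rmx (jac frame_map) \in unitmx.
Proof.
rewrite unitmxE unitfE det_map_mx; apply: (restr_neq0 (irr_set_val x)).
by rewrite -evalmx_det jac_frame_map_x0 det1 oner_neq0.
Qed.

Lemma pval_frame_map y : irr_set X y ->
  \row_j pval (frame_map j) y = y *m Pi.
Proof.
move=> Xy; apply/rowP => j; rewrite !mxE /frame_map pvalD.
have /restr_eq0 -> // := frame_restr fr j; rewrite add0r pval_sum.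
by apply: eq_bigr => i _; rewrite pvalM pvalX pvalC.
Qed.

Lemma pval_frame_map_Pi y :
  (\row_j pval (frame_map j) y) *m Pi = y *m Pi.
Proof.
have HPi : (\row_j pval (H j) y) *m Pi = 0.
  have := congr1 (fun A => evalmx A y) (frame_eq fr).
  rewrite evalmxM evalmx_const (_ : evalmx 0 y = 0); last first.
    by apply/matrixP => i j; rewrite !mxE pval0.
  by move=> <-; congr (_ *m _); apply/rowP => j; rewrite !mxE.
have -> : \row_j pval (frame_map j) y = \row_j pval (H j) y + y *m Pi.
  apply/rowP => j; rewrite !mxE /frame_map pvalD pval_sum; congr (_ + _).
  by apply: eq_bigr => i _; rewrite pvalM pvalX pvalC.
by rewrite mulmxDl HPi add0r -mulmxA (frame_idem fr).
Qed.

Lemma jac_Pi : jac H *m cmx Pi = 0.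
Proof.
apply/matrixP => i k; have /matrixP/(_ 0 k) := frame_eq fr.
rewrite !mxE => /(congr1 (mderiv i)); rewrite raddf0 raddf_sum => E.
rewrite -[RHS]E; apply: eq_bigr => j _ /=.
by rewrite !mxE mderivM mderivC mulr0 addr0.
Qed.

(* Up to the factor det (jac frame_map), the derivative of h along the curves
   which frame_map sends to lines of direction w *)
Definition frame_field (w : 'rV[R]_n) (h : poly) : poly :=
  (cmx w *m \adj (jac frame_map) *m grad h) 0 0.

(** With J the Jacobian of the chart, v J = det(J) w. Multiplying on the right by 1 - [Pi] gives
    [v *m rmx (jac H) = 0], because [Pi] fixes [w]; then [frame_tangent] applies. *)
Lemma frame_field_restr w h : w *m Pi = w -> restr X h = 0 ->
  restr X (frame_field w h) = 0.
Proof.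
move=> wPi h0; pose v := rmx (cmx w *m \adj (jac frame_map)).
suff vh : v *m rmx (grad h) = 0.
  rewrite /frame_field; have := congr1 (fun A : 'M[K]_1 => A 0 0) vh.
  by rewrite -map_mxM !mxE.
apply: (frame_tangent fr) => //.
have vJ : v *m rmx (jac frame_map) = restr X (\det (jac frame_map)) *: rmx (cmx w).
  by rewrite /v -map_mxM -mulmxA mul_adj_mx mul_mx_scalar map_mxZ.
have JPi : rmx (jac H) *m rmx (cmx Pi) = 0 by rewrite -map_mxM jac_Pi map_mx0.
move: vJ; rewrite jac_frame_map map_mxD mulmxDr => vJ.
have := congr1 (fun u => u *m (1%:M - rmx (cmx Pi))) vJ.
rewrite -scalemxAl !mulmxBr !mulmx1 mulmxDl -mulmxA JPi mulmx0 add0r -mulmxA.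
rewrite -!map_mxM (frame_idem fr) wPi subrr scaler0.
by rewrite addrK => ->.
Qed.

(** The polynomials in the tangent coordinates y [Pi]; [p] is the composite of [c] with this linear
    map. *)
Definition tangent_subring : {pred K} := fun g => `[< exists c p : poly,
  restr X p = g /\ forall y, pval p y = pval c (y *m Pi) >].

Lemma tangent_subringP g : reflect (exists c p : poly,
    restr X p = g /\ forall y, pval p y = pval c (y *m Pi))
  (g \in tangent_subring).
Proof. exact: asboolP. Qed.

Lemma tangent_subring_closed : subring_closed tangent_subring.
Proof.
split.
- by apply/tangent_subringP; exists 1, 1; split=> [|y]; rewrite ?restr1 ?pval1.
- move=> _ _ /tangent_subringP[c [p [<- pE]]] /tangent_subringP[c' [p' [<- p'E]]].
  apply/tangent_subringP; exists (c - c'), (p - p'); split=> [|y].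
    by rewrite restrB.
  by rewrite !pvalB pE p'E.
- move=> _ _ /tangent_subringP[c [p [<- pE]]] /tangent_subringP[c' [p' [<- p'E]]].
  apply/tangent_subringP; exists (c * c'), (p * p'); split=> [|y].
    by rewrite restrM.
  by rewrite !pvalM pE p'E.
Qed.

HB.instance Definition _ :=
  GRing.isSubringClosed.Build K tangent_subring tangent_subring_closed.

(** Otherwise some derivation is 0 on the tangent coordinates and 1 at [Q]. Its vector of values on
    the coordinates annihilates [Pi] and the Jacobian of [H], hence the invertible Jacobian of the
    chart, so it is zero; but then so is the value at [Q]. *)
Lemma frame_transcendental Q : ~ transcendental_over tangent_subring (restr X Q).
Proof.
pose S := tangent_subring : subringClosed K => trQ.
have d0 : derivation_on S (fun=> 0).
  by split=> a b _ _; rewrite ?addr0 // mulr0 mul0r addr0.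
have [D [dD D0 DQ]] := derivation_extend (restr X Q) d0 1 (pchar_rat_field X).
pose S1 := adjoin S (restr X Q) : subringClosed K.
have SC c : restr X (mpolyC n c) \in S.
  by apply/tangent_subringP; exists (mpolyC n c), (mpolyC n c); split=> // y; rewrite !pvalC.
have SC1 c : restr X (mpolyC n c) \in S1 by apply: sub_adjoin; exact: SC.
have [S2 [D' [dD' SS2 D'D SX]]] := derivation_extend_mpoly (pchar_rat_field X) dD SC1.
have D'S a : a \in S -> D' a = 0.
  by move=> aS; rewrite D'D ?D0 //; exact: sub_adjoin.
have DE p : restr X p \in S2 /\
    D' (restr X p) = \sum_i D' (restr X (var i)) * restr X (mderiv i p).
  exact: (derivation_mpoly dD' (fun c => SS2 _ (SC1 c)) (fun c => D'S _ (SC c)) SX).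
pose v : 'rV[K]_n := \row_i D' (restr X (var i)).
have vE p : (v *m rmx (grad p)) 0 0 = D' (restr X p).
  by rewrite (DE p).2 mxE; apply: eq_bigr => i _; rewrite !mxE.
have vPi : v *m rmx (cmx Pi) = 0.
  apply/rowP => j; pose p : poly := \sum_i var i * mpolyC n (Pi i j).
  have pS : restr X p \in S.
    apply/tangent_subringP; exists (var j), p; split=> // y.
    rewrite pvalX mxE pval_sum; apply: eq_bigr => i _.
    by rewrite pvalM pvalX pvalC.
  have := D'S _ pS; rewrite -vE !mxE => E; rewrite -[RHS]E.
  by apply: eq_bigr => i _; rewrite !mxE /p mderiv_linear_form.
have vJ : v *m rmx (jac frame_map) = 0.
  rewrite jac_frame_map map_mxD mulmxDr vPi addr0; apply/rowP => j.
  have := vE (H j); rewrite (frame_restr fr) (derivation_on0 dD') !mxE => E.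
  by rewrite -[RHS]E; apply: eq_bigr => i _; rewrite !mxE.
have v0 : v = 0 by rewrite -[v](mulmxK frame_map_unit) vJ mul0mx.
have := vE Q; rewrite v0 mul0mx mxE D'D ?mem_adjoin // DQ // => /eqP.
by rewrite eq_sym oner_eq0.
Qed.

(* Q is algebraic over R[y Pi]; take the constant coefficient of an equation. *)
Lemma frame_algebraic Q : restr X Q != 0 -> exists c w : poly,
  (exists2 y1, irr_set X y1 & pval c (y1 *m Pi) != 0) /\
  forall y, irr_set X y -> pval c (y *m Pi) = pval Q y * pval w y.
Proof.
move=> Q0; have /existsNP[P /not_implyP[SP /not_implyP[PQ /eqP P0]]] :=
  @frame_transcendental Q.
have [g [gS g0 [w gE]]] : exists g, [/\ g \in tangent_subring, g != 0
    & exists w, g = restr X Q * restr X w].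
  (* Zero constant coefficients are divided out, as [restr X Q] is nonzero; the first nonzero one is
     a multiple of [restr X Q]. *)
  elim/poly_ind: P SP PQ P0 => [|P c IHP SP PQ P0]; first by rewrite eqxx.
  have Sc : c \in tangent_subring.
    by have := polyOverP SP 0; rewrite coefD coefMX coefC eqxx add0r.
  have {}SP : P \is a polyOver tangent_subring.
    apply/polyOverP => i; have := polyOverP SP i.+1.
    by rewrite coefD coefMX coefC /= addr0.
  have [c0|c0] := eqVneq c 0.
    move: PQ P0; rewrite c0 addr0 hornerMX => /eqP.
    rewrite mulf_eq0 (negbTE Q0) orbF => /eqP PQ PX.
    by apply: IHP => //; apply: contra_neq PX => ->; rewrite mul0r.
  exists c; split=> //.
  have [w wE] : exists w, restr X w = P.[restr X Q].
    elim/poly_ind: P SP {IHP PQ P0} => [_|P b IHP SP]; first by exists 0; rewrite horner0 restr0.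
    have /tangent_subringP[_ [p [pE _]]] : b \in tangent_subring.
      by have := polyOverP SP 0; rewrite coefD coefMX coefC eqxx add0r.
    have [|w wE] := IHP.
      apply/polyOverP => i; have := polyOverP SP i.+1.
      by rewrite coefD coefMX coefC /= addr0.
    by exists (w * Q + p); rewrite restrD restrM hornerMXaddC wE pE.
  exists (- w); move: PQ; rewrite hornerMXaddC -wE -sub0r restrB restr0 sub0r.
  by rewrite mulrN mulrC => /eqP; rewrite addrC addr_eq0 => /eqP.
have /tangent_subringP[c [p [pE cE]]] := gS.
exists c, w; split; last first.
  by move=> y Xy; rewrite -cE -pvalM; apply: (restr_eq X _ _).1 => //; rewrite pE gE restrM.
apply: contrapT => nc; move: g0; rewrite -pE => /eqP; apply; apply/restr_eq0 => y Xy.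
by apply/eqP/negPn/negP; rewrite cE => c0; apply: nc; exists y.
Qed.

End Frame.
End Frames.

(** * The inverse function theorem for polynomial maps *)

HB.instance Definition _ (R : realType) (m n : nat) := Complete.on 'M[R]_(m, n).

Section MatrixNorm.
Variable R : realType.

Lemma mx_norm_ge m n (x : 'M[R]_(m, n)) i j : `|x i j| <= `|x|.
Proof.
rewrite [leRHS]/Num.norm /= mx_normrE.
by apply: (le_bigmax _ (fun ij : 'I_m * 'I_n => `|x ij.1 ij.2|) (i, j)).
Qed.

Lemma mx_norm_le m n (x : 'M[R]_(m, n)) c : 0 <= c ->
  (forall i j, `|x i j| <= c) -> `|x| <= c.
Proof.
move=> c0 xc; rewrite [leLHS]/Num.norm /= mx_normrE.
by apply/bigmax_leP; split => // -[i j] _; exact: xc.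
Qed.

Lemma mx_norm_mulmx n (v : 'rV[R]_n) (A : 'M[R]_n) c : 0 <= c ->
  (forall i j, `|A i j| <= c) -> `|v *m A| <= n%:R * c * `|v|.
Proof.
move=> c0 Ac; apply: mx_norm_le => [|i j]; first by rewrite !mulr_ge0.
rewrite mxE; apply: le_trans (ler_norm_sum _ _ _) _.
have -> : n%:R * c * `|v| = \sum_(k < n) `|v| * c.
  by rewrite sumr_const card_ord -mulr_natl; ring.
apply: ler_sum => k _; rewrite normrM ler_pM //; exact: mx_norm_ge.
Qed.

End MatrixNorm.

Section Hadamard.
Variables (R : realType) (n : nat).
Local Notation poly := (mpoly n R).
Local Notation V := 'rV[R]_n.
Local Notation var i := (mpolyX R (mnm1 i) : poly).

Lemma pval_continuous (p : poly) : continuous (fun y : V => pval p y).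
Proof.
elim/mpoly_ring_ind: p => [c|i|p q cp cq|p q cp cq].
- rewrite (_ : (fun y => _) = cst c); first exact: cst_continuous.
  by apply/funext => y; rewrite pvalC.
- rewrite (_ : (fun y => _) = (fun y : V => y 0 i)); first exact: coord_continuous.
  by apply/funext => y; rewrite pvalX.
- rewrite (_ : (fun y => _) = (fun y => pval p y + pval q y)).
    by move=> y; exact: (cvgD (cp y) (cq y)).
  by apply/funext => y; rewrite pvalD.
- rewrite (_ : (fun y => _) = (fun y => pval p y * pval q y)).
    by move=> y; exact: (cvgM (cp y) (cq y)).
  by apply/funext => y; rewrite pvalM.
Qed.

Lemma hadamard_ex (p : poly) : exists a : 'I_n -> V -> poly,
  [/\ forall y z : V, pval p y - pval p z = \sum_i (y 0 i - z 0 i) * pval (a i z) y,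
      forall i, continuous (fun yz : V * V => pval (a i yz.2) yz.1)
    & forall i z, pval (a i z) z = pval (mderiv i p) z].
Proof.
elim/mpoly_ring_ind: p => [c|j|p q [a [aE ac ad]] [b [bE bc bd]]|
  p q [a [aE ac ad]] [b [bE bc bd]]].
- exists (fun _ _ => 0); split=> [y z|i|i z].
  + by rewrite !pvalC subrr big1 // => i _; rewrite mulr0.
  + rewrite (_ : (fun yz : V * V => pval 0 yz.1) = cst 0); first exact: cst_continuous.
    by apply/funext => ?; rewrite pval0.
  + by rewrite mderivC pval0.
- exists (fun i _ => (i == j)%:R); split=> [y z|i|i z].
  + rewrite !pvalX (bigD1 j) //= eqxx pval1 mulr1 big1 ?addr0 // => i /negbTE ->.
    by rewrite pval0 mulr0.
  + rewrite (_ : (fun yz : V * V => pval (i == j)%:R yz.1) = cst (i == j)%:R).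
      exact: cst_continuous.
    by apply/funext => ?; case: eqP; rewrite ?pval1 ?pval0.
  + by rewrite mderiv_var.
- exists (fun i z => a i z + b i z); split=> [y z|i|i z].
  + rewrite !pvalD opprD addrACA aE bE -big_split; apply: eq_bigr => i _ /=.
    by rewrite pvalD mulrDr.
  + rewrite (_ : (fun yz => _) =
        (fun yz : V * V => pval (a i yz.2) yz.1 + pval (b i yz.2) yz.1)).
      by move=> yz; exact: (cvgD (ac i yz) (bc i yz)).
    by apply/funext => ?; rewrite pvalD.
  + by rewrite mderivD !pvalD ad bd.
- exists (fun i z => a i z * q + mpolyC n (pval p z) * b i z); split=> [y z|i|i z].
  + transitivity ((pval p y - pval p z) * pval q y + pval p z * (pval q y - pval q z)).
      by rewrite !pvalM; ring.
    rewrite aE bE mulr_suml mulr_sumr -big_split; apply: eq_bigr => i _ /=.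
    by rewrite pvalD !pvalM pvalC; ring.
  + rewrite (_ : (fun yz => _) = (fun yz : V * V =>
        pval (a i yz.2) yz.1 * pval q yz.1 + pval p yz.2 * pval (b i yz.2) yz.1)); last first.
      by apply/funext => ?; rewrite pvalD !pvalM pvalC.
    move=> yz; apply: cvgD; apply: cvgM; [exact: ac| | |exact: bc].
      exact: (continuous_comp (@cvg_fst _ _ _ _ _) (@pval_continuous q yz.1)).
    exact: (continuous_comp (@cvg_snd _ _ _ _ _) (@pval_continuous p yz.2)).
  + by rewrite mderivM !pvalD !pvalM pvalC ad bd.
Qed.

Definition hadamard (p : poly) : 'I_n -> V -> poly := sval (cid (hadamard_ex p)).

Definition dquot (p : poly) (z : V) : 'cV[poly]_n := \col_i hadamard p i z.

Definition jacquot (f : 'I_n -> poly) (z : V) : 'M[poly]_n :=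
  \matrix_(i, j) hadamard (f j) i z.

Definition pmap (f : 'I_n -> poly) (y : V) : V := \row_j pval (f j) y.

Lemma dquotE p (y z : V) :
  pval p y - pval p z = ((y - z) *m evalmx (dquot p z) y) 0 0.
Proof.
rewrite /dquot /hadamard; case: cid => /= a [-> _ _].
by rewrite mxE; apply: eq_bigr => i _; rewrite !mxE.
Qed.

Lemma jacquotE f (y z : V) :
  pmap f y - pmap f z = (y - z) *m evalmx (jacquot f z) y.
Proof.
apply/rowP => j; rewrite !mxE dquotE mxE.
by apply: eq_bigr => i _; rewrite !mxE.
Qed.

Lemma jacquot_diag f (z : V) : evalmx (jacquot f z) z = evalmx (jac f) z.
Proof.
apply/matrixP => i j; rewrite !mxE /hadamard.
by case: cid => /= a [_ _ ->].
Qed.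

Lemma dquot_diag p (z : V) : evalmx (dquot p z) z = evalmx (grad p) z.
Proof.
apply/matrixP => i j; rewrite !mxE /hadamard.
by case: cid => /= a [_ _ ->].
Qed.

Lemma jacquot_continuous f i j :
  continuous (fun yz : V * V => evalmx (jacquot f yz.2) yz.1 i j).
Proof.
rewrite (_ : (fun yz => _) = (fun yz => pval (hadamard (f j) i yz.2) yz.1)).
  by rewrite /hadamard; case: cid => /= a [_ + _]; apply.
by apply/funext => ?; rewrite !mxE.
Qed.

(** Near [x0] the matrix of divided differences is so close to 1 that their difference at least
    halves norms; hence its invertibility and the Lipschitz bound. Surjectivity comes from Banach's
    fixed point theorem. *)
Lemma polynomial_chart (f : 'I_n -> poly) (x0 : V) : evalmx (jac f) x0 = 1%:M ->
  exists2 e : R, 0 < e &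
  (forall y z, `|y - x0| <= e -> `|z - x0| <= e ->
     evalmx (jacquot f z) y \in unitmx /\ `|y - z| <= 2 * `|pmap f y - pmap f z|) /\
  (forall t, `|t - pmap f x0| <= e / 2 ->
     exists2 y, `|y - x0| <= e & pmap f y = t).
Proof.
move=> jac1; pose c : R := (2 * n.+1%:R)^-1.
have c0 : 0 < c by rewrite invr_gt0 mulr_gt0.
have nc : n%:R * c <= 1 / 2.
  rewrite /c invfM mulrC -mulrA div1r ger_pMr ?invr_gt0 // mulrC.
  by rewrite ler_pdivrMr ?mul1r ?ler_nat.
pose g (ij : 'I_n * 'I_n) (yz : V * V) : Prop :=
  `|(1%:M - evalmx (jacquot f yz.2) yz.1) ij.1 ij.2| < c.
have FF : Filter (nbhs ((x0, x0) : V * V)) by typeclasses eauto.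
have : nbhs ((x0, x0) : V * V) [set yz | forall ij, g ij yz].
  apply: (filter_forall FF) => -[i j]; rewrite /g /=.
  have := @jacquot_continuous f i j (x0, x0); rewrite /continuous_at /= jacquot_diag jac1.
  move=> /cvgrPdist_lt /(_ c c0); apply: filterS => yz; by rewrite !mxE.
move=> /nbhs_ballP[e0 /= e0p e0P]; pose e := e0 / 2.
have e_gt0 : 0 < e by rewrite divr_gt0.
have eP (y z v : V) : `|y - x0| <= e -> `|z - x0| <= e ->
    `|v *m (1%:M - evalmx (jacquot f z) y)| <= 1 / 2 * `|v|.
  move=> ye ze.
  have b (w : V) : `|w - x0| <= e -> ball x0 e0 w.
    rewrite -ball_normE /ball_ /= distrC => /le_lt_trans; apply.
    by rewrite /e ltr_pdivrMr // ltr_pMr // ltr1n.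
  apply: (le_trans (mx_norm_mulmx _ (ltW c0) _)) => [i j|].
    by apply: ltW; exact: (e0P (y, z) (conj (b _ ye) (b _ ze)) (i, j)).
  by rewrite ler_wpM2r.
exists e => //; split.
  move=> y z ye ze; set A := evalmx _ _.
  have AP (v : V) : `|v| <= 2 * `|v *m A|.
    have : `|v| <= `|v *m A| + 1 / 2 * `|v|.
      have vE : v = v *m A + v *m (1%:M - A) by rewrite mulmxBr mulmx1 addrC subrK.
      have := eP y z v ye ze; rewrite -/A => vA.
      have := ler_normD (v *m A) (v *m (1%:M - A)); rewrite -vE => /le_trans; apply.
      by rewrite lerD2l.
    by move: `|v| `|v *m A| => a b; lra.
  split; last by rewrite jacquotE; exact: AP.
  rewrite -row_free_unit -kermx_eq0; apply/eqP/row_matrixP => i; rewrite row0.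
  apply/eqP; rewrite -normr_le0; have := AP (row i (kermx A)).
  have -> : row i (kermx A) *m A = 0 by apply: (sub_kermxP (row_sub _ _)).
  by rewrite normr0 mulr0.
move=> t tx; pose U := [set y : V | `|y - x0| <= e].
(* A fixed point of [T] is a preimage of [t]. [T] at least halves distances and moves [x0] by at
   most e / 2, so it preserves the closed ball of radius [e]. *)
pose T (y : V) : V := y - pmap f y + t.
have TB (y z : V) : T y - T z = (y - z) *m (1%:M - evalmx (jacquot f z) y).
  by rewrite mulmxBr mulmx1 -jacquotE /T; apply/rowP => j; rewrite !mxE; ring.
have TU : set_fun U U T.
  move=> y ye0; have ye : `|y - x0| <= e by []; rewrite /U /=.
  have -> : T y - x0 = (T y - T x0) + (t - pmap f x0).
    by rewrite /T !opprD !opprK; apply/rowP => j; rewrite !mxE; ring.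
  apply: le_trans (ler_normD _ _) _; rewrite TB.
  have x0e : `|x0 - x0| <= e by rewrite subrr normr0 ltW.
  have := eP y x0 (y - x0) ye x0e.
  by move: tx ye; move: `|_ - _| `|_ *m _| `|_ - _| => p q r; lra.
have ctr : is_contraction (mkfun_fun TU).
  exists (1 / 2)%:nng; split=> /=; first by rewrite div1r invf_lt1 // ltr1n.
  move=> [y z] [/= ye ze]; rewrite -[mkfun_fun TU y]/(T y) -[mkfun_fun TU z]/(T z) TB.
  exact: eP.
have [||y Uy yT] := banach_fixed_point ctr.
- rewrite (_ : U = closed_ball_ Num.norm x0 e); first exact: closed_closed_ball_.
  by apply/seteqP; split=> y; rewrite /U /closed_ball_ /= distrC.
- by exists x0; rewrite /U /= subrr normr0 ltW.
exists y => //; move: yT; rewrite -[mkfun_fun TU y]/(T y) /T => E.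
apply/rowP => j; have /rowP/(_ j) := E; rewrite !mxE => E'.
by move: E'; move: (y 0 j) (pval _ _) (t 0 j) => a b c'; lra.
Qed.

End Hadamard.

(** * Curves *)

Section RealFunctions.
Variable R : realType.
Implicit Types (f g phi : R -> R).

Lemma is_derive_caratheodory f phi (s0 : R) : {for s0, continuous phi} ->
  (\forall s \near s0, f s - f s0 = (s - s0) * phi s) ->
  is_derive s0 1 f (phi s0).
Proof.
move=> cphi fE.
have lim : h^-1 *: ((f \o shift s0) (h *: 1) - f s0) @[h --> 0^'] --> phi s0.
  have c0 : h + s0 @[h --> 0^'] --> s0.
    have : h + s0 @[h --> (0 : R)] --> 0 + s0 by apply: cvgD; [exact: cvg_id|exact: cvg_cst].
    rewrite add0r; apply: cvg_trans; apply: cvg_app; exact: cvg_within.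
  have : phi (h + s0) @[h --> 0^'] --> phi s0 by apply: cvg_comp c0 cphi.
  apply: cvg_trans; apply: near_eq_cvg.
  have hf : \forall h \near 0^', f (h + s0) - f s0 = (h + s0 - s0) * phi (h + s0).
    exact: c0 fE.
  have hn : \forall h \near (0 : R)^', h != 0 by exact: nbhs_dnbhs_neq.
  near=> h; rewrite /= [h *: 1]mulr1 (near hf h) // addrK.
  have h0 : h != 0 by near: h.
  by rewrite -[_ *: _]/(_ * _) mulKf.
split; first by apply/cvg_ex; exists (phi s0).
exact: cvg_lim.
Unshelve. all: by end_near. Qed.

(** By the mean value theorem G(s) exp(-C s) does not increase after [s1], and G(s) exp(C s) does
    not decrease before it; both vanish at [s1]. *)
Lemma gronwall_zero (G dG : R -> R) (a b C s1 s2 : R) :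
  {in `[a, b], forall s : R, is_derive s 1 G (dG s)} ->
  {in `[a, b], forall s : R, 0 <= G s /\ `|dG s| <= C * G s} ->
  s1 \in `[a, b] -> s2 \in `[a, b] -> G s1 = 0 -> G s2 = 0.
Proof.
move=> dGE GC s1ab s2ab G1.
have [G2 _] := GC _ s2ab.
suff : G s2 <= 0 by move=> G2'; apply/eqP; rewrite eq_le G2 G2'.
pose F k s := G s * expR (k * s).
have dF (k s : R) : s \in `[a, b] -> is_derive s 1 (F k) ((dG s + k * G s) * expR (k * s)).
  move=> /dGE dGs.
  have dk : is_derive s 1 (fun s => k * s) k.
    have := is_deriveZ k (@is_derive_id R R s 1).
    by rewrite -[k *: 1]/(k * 1) mulr1.
  have de := is_derive1_comp (is_derive_expR (k * s)) dk.
  have := is_deriveM dGs de; rewrite /F -[G * _]/(fun s => G s * expR (k * s)).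
  by move=> d; apply: is_derive_eq d _; rewrite -![_ *: _]/(_ * _) /=; ring.
have mv (k u v : R) : u \in `[a, b] -> v \in `[a, b] -> u <= v ->
    exists2 c, c \in `[a, b] & F k v - F k u = (dG c + k * G c) * expR (k * c) * (v - u).
  move=> uab vab uv.
  have sub c : c \in `[u, v] -> c \in `[a, b].
    move: uab vab; rewrite !in_itv /= => /andP[au _] /andP[_ vb] /andP[uc cv].
    by rewrite (le_trans au uc) (le_trans cv vb).
  have dFo c : c \in `]u, v[ -> is_derive c 1 (F k) ((dG c + k * G c) * expR (k * c)).
    by move=> cuv; apply/dF/sub; exact: subset_itv_oo_cc cuv.
  have cF : {within `[u, v], continuous (F k)}.
    by apply: derivable_within_continuous => c cuv; have [] := dF k c (sub c cuv).
  have [c cuv E] := MVT_segment uv dFo cF.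
  by exists c => //; exact: sub.
have [s12|s21] := leP s1 s2.
  have [c cab] := mv (- C) s1 s2 s1ab s2ab s12.
  have [_ dGc] := GC c cab.
  rewrite /F G1 mul0r subr0 => E.
  rewrite -(pmulr_lle0 _ (expR_gt0 (- C * s2))) E.
  rewrite mulr_le0_ge0 ?subr_ge0 // mulr_le0_ge0 ?expR_ge0 //.
  by move: (ler_norm (dG c)) dGc; lra.
have [c cab] := mv C s2 s1 s2ab s1ab (ltW s21).
have [_ dGc] := GC c cab.
rewrite /F G1 mul0r sub0r => E.
rewrite -(pmulr_lle0 _ (expR_gt0 (C * s2))) -oppr_ge0 E.
rewrite mulr_ge0 ?subr_ge0 ?(ltW s21) // mulr_ge0 ?expR_ge0 //.
by move: (ler_norm (- dG c)) dGc; rewrite normrN; lra.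
Qed.

End RealFunctions.

Section Curves.
Variables (R : realType) (n : nat).
Local Notation poly := (mpoly n R).
Local Notation V := 'rV[R]_n.
Local Notation cmx := (map_mx (@mpolyC n R)).
Variables (f : 'I_n -> poly) (x0 : V) (e : R).
Hypothesis chart : forall y z, `|y - x0| <= e -> `|z - x0| <= e ->
  evalmx (jacquot f z) y \in unitmx /\ `|y - z| <= 2 * `|pmap f y - pmap f z|.
Variables (I : interval R) (w : V) (gam : R -> V).
Hypothesis gam_ball : {in I, forall s, `|gam s - x0| <= e}.
Hypothesis gam_line : {in I &, forall s t, pmap f (gam s) - pmap f (gam t) = (s - t) *: w}.

(* The denominator and numerator of the divided differences along gam *)
Definition curve_den (z : V) : poly := \det (jacquot f z).

Definition curve_num (p : poly) (z : V) : poly :=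
  (cmx w *m \adj (jacquot f z) *m dquot p z) 0 0.

Lemma curve_den_neq0 s t : s \in I -> t \in I ->
  pval (curve_den (gam t)) (gam s) != 0.
Proof.
move=> sI tI; have [] := chart (gam_ball sI) (gam_ball tI).
by rewrite unitmxE unitfE evalmx_det.
Qed.

Lemma curve_den_diag z : pval (curve_den z) z = pval (\det (jac f)) z.
Proof. by rewrite -!evalmx_det jacquot_diag. Qed.

Lemma curve_num_diag p z :
  pval (curve_num p z) z = pval ((cmx w *m \adj (jac f) *m grad p) 0 0) z.
Proof.
have E (J : 'M[poly]_n) (D : 'cV[poly]_n) : pval ((cmx w *m \adj J *m D) 0 0) z =
    (w *m \adj (evalmx J z) *m evalmx D z) 0 0.
  have -> (A : 'M[poly]_1) : pval (A 0 0) z = evalmx A z 0 0 by rewrite mxE.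
  by rewrite !evalmxM evalmx_const evalmx_adj.
by rewrite /curve_num !E jacquot_diag dquot_diag.
Qed.

(** Cramer's rule: (gam s - gam t) A = (s - t) w for the matrix A of divided differences, and both
    sides are multiplied by the adjugate of A. Difference quotients along the curve are thus
    quotients of polynomials whose denominator does not vanish on the curve. *)
Lemma curve_diff p s t : s \in I -> t \in I ->
  (pval p (gam s) - pval p (gam t)) * pval (curve_den (gam t)) (gam s) =
  (s - t) * pval (curve_num p (gam t)) (gam s).
Proof.
move=> sI tI; set A := jacquot f (gam t).
have E : pval (curve_den (gam t)) (gam s) *: (gam s - gam t) =
    (s - t) *: (w *m evalmx (\adj A) (gam s)).
  rewrite scalemxAl -(gam_line sI tI) jacquotE -/A -mulmxA -evalmx_adj mul_mx_adj.
  by rewrite mul_mx_scalar evalmx_det.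
rewrite dquotE mulrC; transitivity
  ((pval (curve_den (gam t)) (gam s) *: (gam s - gam t) *m
     evalmx (dquot p (gam t)) (gam s)) 0 0).
  by rewrite -scalemxAl [RHS]mxE.
rewrite E -scalemxAl [LHS]mxE; congr (_ * _).
by rewrite -[w in LHS](evalmx_const _ (gam s)) -!evalmxM [LHS]mxE.
Qed.

Lemma gam_continuous s : s \in I -> (\forall t \near s, t \in I) ->
  {for s, continuous gam}.
Proof.
move=> sI nI; apply/cvgrPdist_lt => d d0.
have d' : 0 < d / (2 * (`|w| + 1)) by rewrite divr_gt0 // mulr_gt0 // ltr_wpDl.
near=> t.
have tI : t \in I by near: t.
have [_ /le_lt_trans] := chart (gam_ball sI) (gam_ball tI); apply.
rewrite gam_line // normrZ.
have : `|s - t| < d / (2 * (`|w| + 1)).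
  by near: t; exact: (@cvgr_dist_lt _ _ _ _ _ _ _ (@cvg_id _ _) _ d').
rewrite ltr_pdivlMr; last by rewrite mulr_gt0 // ltr_wpDl.
have := normr_ge0 w; have := normr_ge0 (s - t).
move: `|s - t| `|w| => a b a0 b0; nra.
Unshelve. all: by end_near. Qed.

Lemma pval_gam_continuous (p : poly) s : s \in I -> (\forall t \near s, t \in I) ->
  {for s, continuous (fun t => pval p (gam t))}.
Proof.
move=> sI nI; apply: (continuous_comp (gam_continuous sI nI)).
exact: pval_continuous.
Qed.

Lemma is_derive_gam (p : poly) s : s \in I -> (\forall t \near s, t \in I) ->
  is_derive s 1 (fun t => pval p (gam t))
    (pval ((cmx w *m \adj (jac f) *m grad p) 0 0) (gam s) / pval (\det (jac f)) (gam s)).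
Proof.
move=> sI nI.
pose phi t := pval (curve_num p (gam s)) (gam t) / pval (curve_den (gam s)) (gam t).
rewrite -curve_num_diag -curve_den_diag -/(phi s).
apply: is_derive_caratheodory.
  apply: cvgM; first exact: pval_gam_continuous.
  by apply: cvgV; [exact: curve_den_neq0|exact: pval_gam_continuous].
near=> t; have tI : t \in I by near: t.
have den0 := curve_den_neq0 tI sI.
by rewrite /phi mulrA -curve_diff // mulfK.
Unshelve. all: by end_near. Qed.

End Curves.

Lemma cvg_finsum (R : realType) (T J : Type) (F : set_system T) (r : seq J)
    {FF : Filter F} (u : J -> T -> R) (l : J -> R) :
  (forall j, u j t @[t --> F] --> l j) ->
  \sum_(j <- r) u j t @[t --> F] --> \sum_(j <- r) l j.
Proof.
move=> ul; elim: r => [|j r IHr].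
  rewrite big_nil (_ : (fun t => _) = cst 0); first exact: cvg_cst.
  by apply/funext => t; rewrite big_nil.
rewrite big_cons (_ : (fun t => _) = (fun t => u j t + \sum_(k <- r) u k t)).
  exact: cvgD.
by apply/funext => t; rewrite big_cons.
Qed.

(** * Curves contained in X *)

Section FrameCurves.
Variables (R : realType) (n : nat) (X : irrAlgSet R n).
Local Notation poly := (mpoly n R).
Local Notation V := 'rV[R]_n.
Variables (x : X) (H : 'I_n -> poly) (Pi : 'M[R]_n).
Local Notation x0 := (val x).
Hypothesis fr : local_frame X x0 H Pi.
Local Notation f := (frame_map H Pi).
Variable e : R.
Hypothesis e_gt0 : 0 < e.
Hypothesis chart : forall y z, `|y - x0| <= e -> `|z - x0| <= e ->
  evalmx (jacquot f z) y \in unitmx /\ `|y - z| <= 2 * `|pmap f y - pmap f z|.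
Hypothesis chart_onto : forall t, `|t - pmap f x0| <= e / 2 ->
  exists2 y, `|y - x0| <= e & pmap f y = t.
(** An open interval around [0, 1], so that 0 and 1 are interior parameters of the curves. *)
Local Notation I := `](-1)%R, 2%R[.

(** The field of direction [w] preserves the ideal of X, so the derivatives along the curve of
    finitely many generators are combinations of these generators. Gronwall's inequality applies to
    their sum of squares [G], which vanishes at [s1]. *)
Lemma curve_in_X (w : V) (gam : R -> V) : w *m Pi = w ->
  {in I, forall s, `|gam s - x0| <= e} ->
  {in I &, forall s t, pmap f (gam s) - pmap f (gam t) = (s - t) *: w} ->
  forall s1 s2, s1 \in I -> s2 \in I -> irr_set X (gam s1) -> irr_set X (gam s2).
Proof.
move=> wPi gball gline s1 s2 s1I s2I Xs1.
have [|hs hsE] := @ideals_fg_mpoly R n [set p | restr X p = 0].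
  split=> /= [|p q p0 q0|p q q0]; first exact: restr0.
    by rewrite restrD p0 q0 addr0.
  by rewrite restrM q0 mulr0.
have hs0 i : (i < size hs)%N -> restr X hs`_i = 0.
  move=> ih; suff: [set p | restr X p = 0] hs`_i by [].
  by rewrite hsE; apply: mem_generated_by; exact: mem_nth.
have exc (i : 'I_(size hs)) : exists c : 'I_(size hs) -> poly,
    frame_field H Pi w hs`_i = \sum_j c j * hs`_j.
  suff: [set p | restr X p = 0] (frame_field H Pi w hs`_i) by rewrite hsE.
  exact: (frame_field_restr fr wPi (hs0 _ (ltn_ord i))).
have [c cE] := choice exc.
pose g (i : 'I_(size hs)) (s : R) := pval hs`_i (gam s).
pose del s := pval (\det (jac f)) (gam s).
pose G : R -> R := \sum_i (g i) ^+ 2.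
have GE s : G s = \sum_i (g i s) ^+ 2.
  by rewrite /G fct_sumE; apply: eq_bigr => i _; rewrite exprfctE.
have delI s : s \in I -> del s != 0.
  move=> sI; have := curve_den_neq0 chart gball sI sI.
  by rewrite /curve_den -evalmx_det jacquot_diag evalmx_det.
have gE (i : 'I_(size hs)) (s : R) : s \in I ->
    is_derive s 1 (g i) (\sum_j pval (c i j) (gam s) / del s * g j s).
  move=> sI; have := is_derive_gam chart gball gline hs`_i sI (near_in_itvoo sI).
  rewrite -/(del s) -[(_ *m _ *m _) 0 0]/(frame_field H Pi w hs`_i) cE pval_sum.
  rewrite mulr_suml => d; apply: is_derive_eq d _; apply: eq_bigr => j _.
  by rewrite pvalM mulrAC.
pose dG s := \sum_i (2 * g i s) * (\sum_j pval (c i j) (gam s) / del s * g j s).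
have GdG (s : R) : s \in I -> is_derive s 1 G (dG s).
  move=> sI; apply: is_derive_sum => i.
  apply: is_derive_eq (is_deriveX 2 (gE i s sI)) _.
  by rewrite expr1.
pose B s := \sum_i \sum_j `|pval (c i j) (gam s) / del s|.
pose a := Num.min s1 s2; pose b := Num.max s1 s2.
have abI s : s \in `[a, b] -> s \in I.
  move: s1I s2I; rewrite !in_itv /= /a /b => /andP[? ?] /andP[? ?] /andP[].
  rewrite ge_min le_max => /orP[?|?] /orP[?|?]; apply/andP; split; lra.
have Bc : {within `[a, b], continuous B}.
  apply: continuous_in_subspaceT => s; rewrite inE /= => /abI sI.
  have cij i j : `|pval (c i j) (gam t) / del t| @[t --> s] -->
      `|pval (c i j) (gam s) / del s|.
    apply: cvg_norm; apply: cvgM.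
      exact: (pval_gam_continuous chart gball gline sI (near_in_itvoo sI)).
    apply: cvgV; first exact: delI.
    exact: (pval_gam_continuous chart gball gline sI (near_in_itvoo sI)).
  have ci i : \sum_j `|pval (c i j) (gam t) / del t| @[t --> s] -->
      \sum_j `|pval (c i j) (gam s) / del s|.
    exact: (@cvg_finsum _ _ _ (nbhs s)).
  exact: (@cvg_finsum _ _ _ (nbhs s)).
have ab : a <= b by rewrite /a /b ge_min !le_max !lexx.
(* Bounds all coefficients of the linear system at once on the compact segment between [s1] and
   [s2]. *)
have [m _ Bm] := EVT_max ab Bc.
have GdGle s : s \in `[a, b] -> 0 <= G s /\ `|dG s| <= (2 * (size hs)%:R * B m) * G s.
  move=> sab; split; first by rewrite GE sumr_ge0 // => i _; exact: sqr_ge0.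
  have coef i j : `|pval (c i j) (gam s) / del s| <= B m.
    apply: le_trans (Bm s sab); rewrite /B (bigD1 i) //= (bigD1 j) //= -addrA lerDl.
    by rewrite addr_ge0 ?sumr_ge0 // => k _; rewrite ?sumr_ge0.
  apply: (@le_trans _ _ (\sum_i \sum_j B m * ((g i s) ^+ 2 + (g j s) ^+ 2))).
    apply: le_trans (ler_norm_sum _ _ _) _; apply: ler_sum => i _.
    rewrite mulr_sumr; apply: le_trans (ler_norm_sum _ _ _) _; apply: ler_sum => j _.
    rewrite mulrCA normrM ler_pM //.
    rewrite !normrM (ger0_norm (_ : 0 <= 2)) // -(real_normK (num_real (g i s))).
    rewrite -(real_normK (num_real (g j s))).
    have := sqr_ge0 (`|g i s| - `|g j s|); move: `|g i s| `|g j s| => u v; nra.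
  rewrite le_eqVlt; apply/orP; left; apply/eqP.
  transitivity (\sum_i ((size hs)%:R * B m * (g i s) ^+ 2 + B m * G s)).
    apply: eq_bigr => i _; rewrite -mulr_sumr big_split /= sumr_const card_ord -GE.
    by rewrite -mulr_natl; ring.
  rewrite big_split /= -mulr_sumr -GE sumr_const card_ord -mulr_natl; ring.
have Gs1 : G s1 = 0.
  rewrite GE big1 // => i _; rewrite /g.
  by have /restr_eq0 -> // := hs0 _ (ltn_ord i); rewrite expr0n.
have s1ab : s1 \in `[a, b] by rewrite in_itv /= /a /b ge_min le_max lexx.
have s2ab : s2 \in `[a, b] by rewrite in_itv /= /a /b ge_min le_max lexx !orbT.
have := gronwall_zero (fun s sab => GdG s (abI s sab)) GdGle s1ab s2ab Gs1.
rewrite GE => G2.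
have gs2 i : g i s2 = 0.
  have /eqP := @psumr_eq0P _ _ xpredT (fun i => g i s2 ^+ 2)
    (fun i _ => sqr_ge0 (g i s2)) G2 i isT.
  by rewrite sqrf_eq0 => /eqP.
have [S XE] := irr_set_algebraic X; rewrite XE => p Sp.
have p0 : generated_by hs p.
  rewrite -hsE; apply/restr_eq0 => y; rewrite XE; exact.
have [d ->] := p0; rewrite pval_sum big1 // => i _.
by rewrite pvalM [pval hs`_i _]gs2 mulr0.
Qed.

(** A line through the image of [y] is lifted by the chart. The lift passes through [y] because the
    chart is injective, stays in X by [curve_in_X], and stays near [x0] by the Lipschitz bound. *)
Lemma frame_curves : exists2 r : R, 0 < r & exists L : R, forall (y : X) (w : V),
  `|val y - x0| <= r -> `|w| <= r -> w *m Pi = w ->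
  exists gam : R -> X, [/\ gam 0 = y,
    {in I, forall s, `|val (gam s) - x0| <= e},
    {in I, forall s, `|val (gam s) - x0| <= L * (`|val y - x0| + `|w|)}
  & {in I &, forall s t,
      pmap f (val (gam s)) - pmap f (val (gam t)) = (s - t) *: w}].
Proof.
pose k : R := n%:R * `|Pi|.
have k0 : 0 <= k by rewrite mulr_ge0.
have Xval (y : X) : irr_set X (val y) by exact/set_mem/(valP y).
have x0e : `|x0 - x0| <= e by rewrite subrr normr0 ltW.
(* As |s| <= 2, the line stays within (k + 2)(|y - x0| + |w|) <= 2 (k + 2) r <= e / 2 of the image
   of [x0], as [chart_onto] requires. *)
pose r := Num.min e (e / (4 * (k + 2))).
have r0 : 0 < r by rewrite lt_min e_gt0 divr_gt0 // mulr_gt0 // ltr_wpDl.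
exists r => //; exists (2 * (k + 2)) => y w yr wr wPi.
have ye : `|val y - x0| <= e by apply: le_trans yr _; rewrite ge_min lexx.
pose line s := pmap f (val y) + s *: w.
have lineP s : s \in I -> `|line s - pmap f x0| <= (k + 2) * (`|val y - x0| + `|w|).
  rewrite in_itv /= => /andP[s1 s2]; rewrite /line /pmap.
  rewrite (pval_frame_map fr (Xval y)) (pval_frame_map fr (Xval x)) addrAC -mulmxBl.
  apply: le_trans (ler_normD _ _) _.
  have : `|(val y - x0) *m Pi| <= k * `|val y - x0|.
    by apply: mx_norm_mulmx => // i j; exact: mx_norm_ge.
  rewrite normrZ; have : `|s| <= 2 by rewrite ler_norml; apply/andP; split; lra.
  have := normr_ge0 w; have := normr_ge0 (val y - x0); have := normr_ge0 s.
  by move: `|s| `|w| `|_ - _| `|_ *m _| => A B C D; nra.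
have exg s : exists y', s \in I -> [/\ `|y' - x0| <= e & pmap f y' = line s].
  have [sI|nsI] := boolP (s \in I); last by exists x0.
  have [|y' y'e y'E] := chart_onto (t := line s); last by exists y'.
  apply: le_trans (lineP s sI) _.
  have : r <= e / (4 * (k + 2)) by rewrite ge_min lexx orbT.
  rewrite ler_pdivlMr; last by rewrite mulr_gt0 // ltr_wpDl.
  move=> rk; apply: (@le_trans _ _ ((k + 2) * (r + r))); last by move: rk; lra.
  by rewrite ler_wpM2l ?lerD // addr_ge0.
have [g gP] := choice exg.
have g_ball : {in I, forall s, `|g s - x0| <= e} by move=> s /gP[].
have g_line : {in I &, forall s t, pmap f (g s) - pmap f (g t) = (s - t) *: w}.
  move=> s t /gP[_ ->] /gP[_ ->].
  by rewrite /line opprD addrACA subrr add0r scalerBl.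
have I0 : (0 : R) \in I by rewrite in_itv /= ltrN10 ltr0n.
have g0 : g 0 = val y.
  have [_] := chart (g_ball _ I0) ye; have [_ ->] := gP _ I0.
  rewrite /line scale0r addr0 subrr normr0 mulr0 normr_le0 subr_eq0.
  by move/eqP.
have gX s : s \in I -> irr_set X (g s).
  by move=> sI; apply: (curve_in_X wPi g_ball g_line I0 sI); rewrite g0.
have exG s : exists y' : X, s \in I -> val y' = g s.
  have [sI|nsI] := boolP (s \in I); last by exists x.
  by exists (exist _ (g s) (mem_set (gX s sI))).
have [G GE] := choice exG.
exists G; split.
- by apply: val_inj; rewrite GE.
- by move=> s sI; rewrite GE // g_ball.
- move=> s sI; rewrite GE //.
  have [_] := chart (g_ball _ sI) x0e; have [_ ->] := gP _ sI.
  move=> /le_trans; apply; rewrite -mulrA ler_pM2l //; exact: lineP.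
- by move=> s t sI tI; rewrite !GE // g_line.
Qed.

End FrameCurves.

Lemma continuous_dnbhs (R : realType) (U : topologicalType) (g : R -> U) (s : R) :
  {for s, continuous g} -> g t @[t --> s^'] --> g s.
Proof. by move=> cg; apply: cvg_trans cg; apply: cvg_app; exact: cvg_within. Qed.

(** * Removable singularities along a curve *)

Section Removable.
Variables (R : realType) (n : nat).
Local Notation poly := (mpoly n R).
Local Notation V := 'rV[R]_n.
Variables (f : 'I_n -> poly) (x0 : V) (e : R).
Hypothesis chart : forall y z, `|y - x0| <= e -> `|z - x0| <= e ->
  evalmx (jacquot f z) y \in unitmx /\ `|y - z| <= 2 * `|pmap f y - pmap f z|.
Variables (I : interval R) (w : V) (gam : R -> V).
Hypothesis gam_ball : {in I, forall s, `|gam s - x0| <= e}.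
Hypothesis gam_line : {in I &, forall s t, pmap f (gam s) - pmap f (gam t) = (s - t) *: w}.

(* Dividing p and q by s - s0 as long as q vanishes at s0 terminates, because q
   vanishes to order at most N there. *)
Lemma curve_removable (p q : poly) (s0 M : R) (N : nat) (W E : R -> R) :
  s0 \in I -> (\forall s \near s0, s \in I) ->
  {for s0, continuous W} -> {for s0, continuous E} -> E s0 != 0 ->
  (\forall s \near s0^', `|pval p (gam s)| <= M * `|pval q (gam s)|) ->
  (\forall s \near s0^', pval q (gam s) * W s = (s - s0) ^+ N * E s) ->
  exists l : R, pval p (gam s) / pval q (gam s) @[s --> s0^'] --> l.
Proof.
move=> s0I nI + cE E0; have cgam g := pval_gam_continuous chart gam_ball gam_line (p := g) s0I nI.
elim: N p q W => [|N IHN] p q W cW pq qW.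
  (* For N = 0 the limit [E s0] of q times [W] is nonzero, so q does not vanish at [s0]. *)
  exists (pval p (gam s0) / pval q (gam s0)).
  apply: cvgM; first exact/continuous_dnbhs/cgam.
  apply: cvgV; last exact/continuous_dnbhs/cgam.
  have l1 : pval q (gam s) * W s @[s --> s0^'] --> pval q (gam s0) * W s0.
    by apply: cvgM; [exact/continuous_dnbhs/cgam|exact: continuous_dnbhs].
  have l2 : pval q (gam s) * W s @[s --> s0^'] --> E s0.
    have := continuous_dnbhs cE; apply: cvg_trans; apply: near_eq_cvg.
    by apply: filterS qW => s ->; rewrite expr0 mul1r.
  have El := cvg_unique _ l1 l2.
  by apply: contra_neq E0 => q0; rewrite -El // q0 mul0r.
have [q0|q0] := eqVneq (pval q (gam s0)) 0; last first.
  exists (pval p (gam s0) / pval q (gam s0)).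
  apply: cvgM; first exact/continuous_dnbhs/cgam.
  by apply: cvgV; last exact/continuous_dnbhs/cgam.
have p0 : pval p (gam s0) = 0.
  have l1 : `|pval p (gam s)| @[s --> s0^'] --> `|pval p (gam s0)|.
    by apply: cvg_norm; exact/continuous_dnbhs/cgam.
  have l2 : M * `|pval q (gam s)| @[s --> s0^'] --> M * `|pval q (gam s0)|.
    by apply: cvgMr; apply: cvg_norm; exact/continuous_dnbhs/cgam.
  have : `|pval p (gam s0)| <= M * `|pval q (gam s0)| by exact: ler_cvg_to l1 l2 pq.
  by rewrite q0 normr0 mulr0 normr_le0 => /eqP.
pose den s := pval (curve_den f (gam s0)) (gam s).
(* Up to the factor [den], these are p and q divided by s - s0, and they are polynomials again. The
   factor goes into [W] and the order N drops by one. *)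
pose p1 := curve_num f w p (gam s0); pose q1 := curve_num f w q (gam s0).
have den0 : \forall s \near s0^', den s != 0.
  apply: cvg_within; near=> s; apply: (curve_den_neq0 chart gam_ball) => //.
  by near: s.
have pE : \forall s \near s0^', pval p (gam s) * den s = (s - s0) * pval p1 (gam s).
  apply: cvg_within; near=> s; have sI : s \in I by near: s.
  by have := curve_diff gam_line p sI s0I; rewrite p0 subr0.
have qE : \forall s \near s0^', pval q (gam s) * den s = (s - s0) * pval q1 (gam s).
  apply: cvg_within; near=> s; have sI : s \in I by near: s.
  by have := curve_diff gam_line q sI s0I; rewrite q0 subr0.
have sn0 : \forall s \near s0^', s - s0 != 0.
  have : \forall s \near s0^', s != s0 by exact: nbhs_dnbhs_neq.
  by apply: filterS => s; rewrite subr_eq0.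
have [|||l lP] := IHN p1 q1 (fun s => W s / den s).
- apply: cvgM => //; apply: cvgV; last exact: cgam.
  exact: (curve_den_neq0 chart gam_ball).
- near=> s; have s0' : s - s0 != 0 by near: s.
  have : `|pval p (gam s) * den s| <= M * `|pval q (gam s) * den s|.
    by rewrite !normrM mulrA ler_wpM2r //; near: s.
  rewrite (near pE s) // (near qE s) // !normrM mulrCA ler_pM2l ?normr_gt0 //.
- near=> s; have s0' : s - s0 != 0 by near: s.
  apply: (mulfI s0'); rewrite [LHS]mulrA -(near qE s) // mulrACA mulfV ?mulr1; last by near: s.
  by rewrite (near qW s) // exprS mulrA.
exists l; move: lP; apply: cvg_trans; apply: near_eq_cvg; near=> s.
have d0 : den s != 0 by near: s.
have s0' : s - s0 != 0 by near: s.
rewrite -[RHS]mulr1 -(divff d0) mulf_div (near pE s) // (near qE s) //.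
by rewrite -mulf_div divff // mul1r.
Unshelve. all: by end_near. Qed.

End Removable.

(** * Behaviour of an integral rational function along curves *)

Section InducedTopology.
Variables (R : realType) (n : nat) (X : irrAlgSet R n).

Lemma continuous_irrP (g : X -> R) (y : X) : {for y, continuous g} <->
  forall d, 0 < d -> exists2 r, 0 < r &
    forall z : X, `|val z - val y| < r -> `|g z - g y| < d.
Proof.
have bE (r : R) (z : X) : ball y r z <-> `|val z - val y| < r.
  by rewrite -[ball y r z]/(ball (val y) r (val z)) -ball_normE /ball_ /= distrC.
split=> [/cvgrPdist_lt cg d d0|cg].
  have /nbhs_ballP[r r0 rP] := cg d d0; exists r => // z /bE /rP /=.
  by rewrite distrC.
have FF : Filter (nbhs y) by exact: nbhs_filter.
apply/(@cvgrPdist_lt _ _ _ (nbhs y) FF) => d d0; have [r r0 rP] := cg d d0.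
by apply/nbhs_ballP; exists r => // z /bE /rP /=; rewrite distrC.
Qed.

Lemma continuous_irr_comp (gam : R -> X) (g : X -> R) (s : R) :
  {for s, continuous (fun t => val (gam t))} -> {for gam s, continuous g} ->
  {for s, continuous (fun t => g (gam t))}.
Proof.
move=> /cvgrPdist_lt cgam /continuous_irrP cg; apply/cvgrPdist_lt => d d0.
have [r r0 rP] := cg d d0.
by apply: filterS (cgam r r0) => t; rewrite distrC => /rP; rewrite distrC.
Qed.

End InducedTopology.

Lemma pval_line (R : realType) (n : nat) (c : mpoly n R) (y w : 'rV[R]_n) :
  exists u : {poly R}, forall s, u.[s] = pval c (y + s *: w).
Proof.
elim/mpoly_ring_ind: c => [c|i|p q [u uE] [v vE]|p q [u uE] [v vE]].
- by exists c%:P => s; rewrite hornerC pvalC.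
- exists ((w ord0 i)%:P * 'X + (y ord0 i)%:P) => s.
  by rewrite !hornerE pvalX !mxE addrC mulrC.
- by exists (u + v) => s; rewrite hornerD pvalD uE vE.
- by exists (u * v) => s; rewrite hornerM pvalM uE vE.
Qed.

Lemma poly_dnbhs_neq0 (R : realType) (u : {poly R}) (s0 : R) :
  u != 0 -> \forall s \near s0^', u.[s] != 0.
Proof.
move=> u0; have [N [u1]] := multiplicity_XsubC u s0; rewrite u0 /= => u1s0 uN.
have u1c : {for s0, continuous (horner u1)} by exact: continuous_horner.
have u1n0 : \forall s \near s0^', u1.[s] != 0.
  exact: (@cvgr_neq0 _ _ _ _ _ _ _ (continuous_dnbhs u1c) u1s0).
have sn0 : \forall s \near s0^', s != s0 by exact: nbhs_dnbhs_neq.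
near=> s; rewrite uN hornerM horner_exp mulf_neq0 ?expf_neq0 //; first by near: s.
by rewrite !hornerE subr_eq0; near: s.
Unshelve. all: by end_near. Qed.

(** * Monic polynomials with continuous coefficients *)

Section MonicFamily.
Variables (R : realType) (n : nat) (X : irrAlgSet R n).
Variables (m : nat) (a : nat -> X -> R).
Hypothesis acont : forall i, continuous (a i).
Hypothesis am1 : forall y, a m y = 1.

Definition family_eval (y : X) (t : R) : R := \sum_(i < m.+1) a i y * t ^+ i.

(** Cauchy's bound: if |t| > 1, the equation is compared with the power m - 1 of |t|; the summand 1
    covers the other case. *)
Lemma family_root_bound y t : family_eval y t = 0 -> `|t| <= 1 + \sum_(i < m) `|a i y|.
Proof.
rewrite /family_eval big_ord_recr /= am1 mul1r => E.
have S0 : 0 <= \sum_(i < m) `|a i y| by apply: sumr_ge0.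
have [t1|t1] := leP `|t| 1; first by apply: le_trans t1 _; rewrite lerDl.
case: m E S0 => [|k] E S0.
  by move: E; rewrite big_ord0 add0r expr0 => /eqP; rewrite oner_eq0.
have t0 : 0 < `|t| ^+ k by rewrite exprn_gt0 // (lt_trans _ t1).
suff : `|t| <= \sum_(i < k.+1) `|a i y| by move=> /le_trans; apply; rewrite lerDr.
rewrite -(ler_pM2r t0) -exprS -normrX.
have -> : t ^+ k.+1 = - \sum_(i < k.+1) a i y * t ^+ i by apply/eqP; rewrite -addr_eq0 addrC E.
rewrite normrN mulr_suml; apply: le_trans (ler_norm_sum _ _ _) _.
apply: ler_sum => i _; rewrite normrM normrX ler_wpM2l //.
by rewrite ler_weXn2l ?(ltW t1) // -ltnS.
Qed.

Lemma family_eval_cvg (T : Type) (F : set_system T) {FF : Filter F} (g : T -> X)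
    (h : T -> R) (y : X) (l : R) :
  (forall i, a i (g t) @[t --> F] --> a i y) -> h t @[t --> F] --> l ->
  family_eval (g t) (h t) @[t --> F] --> family_eval y l.
Proof.
move=> ga hl; apply: cvg_finsum => i; apply: cvgM; first exact: ga.
elim: (i : nat) => [|k IHk].
  rewrite expr0 (_ : (fun t => _) = cst 1); first exact: cvg_cst.
  by apply/funext => t; rewrite expr0.
rewrite exprS (_ : (fun t => _) = (fun t => h t * h t ^+ k)); first exact: cvgM.
by apply/funext => t; rewrite exprS.
Qed.

Lemma family_eval_continuous t : continuous (fun y => family_eval y t).
Proof.
move=> y; apply: (@family_eval_cvg _ (nbhs y) _ id (fun=> t)); last exact: cvg_cst.
by move=> i; exact: acont.
Qed.

Lemma family_nonroot y t1 t2 : t1 < t2 ->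
  exists2 t, t1 < t < t2 & family_eval y t != 0.
Proof.
move=> t12; pose P : {poly R} := \poly_(i < m.+1) a i y.
have PE t : P.[t] = family_eval y t by rewrite horner_poly.
have P0 : P != 0.
  apply/eqP => /(congr1 (fun Q : {poly R} => Q`_m)); rewrite coef_poly ltnSn am1 coef0.
  by move/eqP; rewrite oner_eq0.
apply: contrapT => nt.
(* These are distinct points of ]t1, t2[, as many as the size of [P], which exceeds its number of
   roots; [i.+2] keeps them below [t2]. *)
pose g (i : nat) := t1 + (t2 - t1) / i.+2%:R.
pose s := [seq g i | i <- iota 0 (size P)].
have : (size s < size P)%N.
  apply: max_poly_roots => //.
    apply/allP => _ /mapP[i _ ->]; apply/eqP; rewrite PE; apply/eqP/negPn/negP => gi.
    apply: nt; exists (g i) => //; rewrite /g ltrDl divr_gt0 ?subr_gt0 //=.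
    rewrite -ltrBrDl ltr_pdivrMr // ltr_pMr ?subr_gt0 // ltr1n //.
  rewrite map_inj_uniq ?iota_uniq // => i j /addrI /(mulfI _) E.
  have : i.+2%:R^-1 = j.+2%:R^-1 :> R by apply: E; rewrite subr_eq0 gt_eqF.
  by move=> /invr_inj /eqP; rewrite eqr_nat => /eqP [].
by rewrite size_map size_iota ltnn.
Qed.

End MonicFamily.

(** * Values of p / q along a curve in X *)

Section Crossing.
Variables (R : realType) (n : nat) (X : irrAlgSet R n).
Local Notation poly := (mpoly n R).
Local Notation V := 'rV[R]_n.
Variables (m : nat) (a : nat -> X -> R).
Hypothesis acont : forall i, continuous (a i).
Hypothesis am1 : forall y, a m y = 1.
Variables (p q Q : poly).
Hypothesis pq_root : forall y : X, pval (q * Q) (val y) != 0 ->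
  family_eval m a y (pval p (val y) / pval q (val y)) = 0.
Variables (x : X) (H : 'I_n -> poly) (Pi : 'M[R]_n).
Local Notation x0 := (val x).
Hypothesis fr : local_frame X x0 H Pi.
Local Notation f := (frame_map H Pi).
Variable e : R.
Hypothesis chart : forall y z, `|y - x0| <= e -> `|z - x0| <= e ->
  evalmx (jacquot f z) y \in unitmx /\ `|y - z| <= 2 * `|pmap f y - pmap f z|.
Local Notation I := `](-1)%R, 2%R[.
Variables (c b : poly).
Hypothesis cE : forall y, irr_set X y -> pval c (y *m Pi) = pval (q * Q) y * pval b y.
Variables (w : V) (gam : R -> X).
Hypothesis wPi : w *m Pi = w.
Hypothesis gam_ball : {in I, forall s, `|val (gam s) - x0| <= e}.
Hypothesis gam_line : {in I &, forall s t,
  pmap f (val (gam s)) - pmap f (val (gam t)) = (s - t) *: w}.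
Local Notation frac y := (pval p (val y) / pval q (val y)).

Let Xval (y : X) : irr_set X (val y). Proof. exact/set_mem/(valP y). Qed.

Let cgam (s : R) : s \in I -> {for s, continuous (fun t => val (gam t))}.
Proof. by move=> sI; apply: (gam_continuous chart gam_ball gam_line sI); exact: near_in_itvoo. Qed.

(** A point and its image under the chart have the same product with [Pi], so the tangent
    coordinates are affine in the parameter. *)
Lemma gam_Pi s : s \in I -> val (gam s) *m Pi = val (gam 0) *m Pi + s *: w.
Proof.
move=> sI; have I0 : (0 : R) \in I by rewrite in_itv /= ltrN10 ltr0n.
rewrite -(pval_frame_map_Pi fr (val (gam s))) -(pval_frame_map_Pi fr (val (gam 0))).
rewrite -/(pmap f (val (gam s))) -/(pmap f (val (gam 0))).
apply/eqP; rewrite addrC -subr_eq -mulmxBl gam_line // subr0.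
by rewrite -scalemxAl wPi.
Qed.

(** Along the curve c(y [Pi]) is a nonzero polynomial in the parameter and a multiple of q Q, which
    bounds the order of the zeros of q, while [family_root_bound] bounds p / q. So [curve_removable]
    applies, and the equation passes to the limit. *)
Lemma curve_limit (s0 : R) : s0 \in I -> pval c (val (gam 0) *m Pi) != 0 ->
  exists l, frac (gam s) @[s --> s0^'] --> l /\ family_eval m a (gam s0) l = 0.
Proof.
move=> s0I c0.
have I0 : (0 : R) \in I by rewrite in_itv /= ltrN10 ltr0n.
have [u uE] := pval_line c (val (gam 0) *m Pi) w.
have ugam s : s \in I -> u.[s] = pval c (val (gam s) *m Pi).
  by move=> sI; rewrite uE (gam_Pi sI).
have u0 : u != 0.
  by apply: contra_neq c0 => u0; rewrite -ugam // u0 horner0.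
have [N [u1]] := multiplicity_XsubC u s0; rewrite u0 /= => u1s0 uN.
have uS s : u.[s] = (s - s0) ^+ N * u1.[s] by rewrite uN hornerM horner_exp !hornerE mulrC.
have u1c : {for s0, continuous (horner u1)} by exact: continuous_horner.
have un0 := poly_dnbhs_neq0 s0 u0.
have sI : \forall s \near s0^', s \in I by apply: cvg_within; exact: near_in_itvoo.
have Qn0 : \forall s \near s0^', pval (q * Q) (val (gam s)) != 0.
  near=> s; have := near un0 s; rewrite ugam; last by near: s.
  by rewrite cE // mulf_eq0 negb_or => /(_ _)/andP[].
have rootn : \forall s \near s0^', family_eval m a (gam s) (frac (gam s)) = 0.
  by apply: filterS Qn0 => s; exact: pq_root.
have ca i : a i (gam s) @[s --> s0^'] --> a i (gam s0).
  apply: (@continuous_dnbhs _ _ (fun s => a i (gam s))).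
  by apply: continuous_irr_comp; [exact: cgam|exact: acont].
pose B s := 1 + \sum_(i < m) `|a i (gam s)|.
have cB : B s @[s --> s0^'] --> B s0.
  apply: cvgD; first exact: cvg_cst.
  by apply: cvg_finsum => i; apply: cvg_norm; exact: ca.
have Bn : \forall s \near s0^', B s < B s0 + 1.
  by apply: (cvgr_lt _ cB); rewrite ltrDl.
have bnd : \forall s \near s0^', `|pval p (val (gam s))| <= (B s0 + 1) * `|pval q (val (gam s))|.
  near=> s; have : pval (q * Q) (val (gam s)) != 0 by near: s.
  rewrite pvalM mulf_eq0 negb_or => /andP[q0 _].
  rewrite -ler_pdivrMr ?normr_gt0 // -normf_div.
  apply: le_trans (family_root_bound am1 (near rootn s _)) _ => //.
  by apply: ltW; near: s.
have [||l fl] := curve_removable (W := fun s => pval Q (val (gam s)) * pval b (val (gam s)))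
  chart gam_ball gam_line s0I (near_in_itvoo s0I) _ u1c u1s0 bnd (N := N).
- by apply: cvgM; exact: (pval_gam_continuous chart gam_ball gam_line s0I (near_in_itvoo s0I)).
- near=> s; rewrite -uS ugam; last by near: s.
  by rewrite cE // pvalM mulrA.
exists l; split => //.
have l1 : family_eval m a (gam s) (frac (gam s)) @[s --> s0^'] -->
    family_eval m a (gam s0) l by exact: family_eval_cvg.
have l2 : family_eval m a (gam s) (frac (gam s)) @[s --> s0^'] --> (0 : R).
  exact: cvg_near_cst.
exact: cvg_unique l1 l2.
Unshelve. all: by end_near. Qed.

(** The limits from [curve_limit] form a continuous function, equal to p / q at both ends and
    everywhere a root of the family. By the intermediate value theorem it would take the value [t],
    which is never a root. *)
Lemma curve_no_crossing (t : R) : pval c (val (gam 0) *m Pi) != 0 ->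
  pval c (val (gam 1) *m Pi) != 0 ->
  (forall s, s \in I -> family_eval m a (gam s) t != 0) ->
  frac (gam 0) < t -> ~ t < frac (gam 1).
Proof.
move=> c0 c1 tn0 f0t tf1.
have exl (s : R) : exists l : R, s \in I ->
    frac (gam s') @[s' --> s^'] --> l /\ family_eval m a (gam s) l = 0.
  have [sI|] := boolP (s \in I); last by exists 0.
  by have [l lP] := curve_limit sI c0; exists l.
have [l lP] := choice exl.
have lE (s : R) : s \in I -> pval c (val (gam s) *m Pi) != 0 -> l s = frac (gam s).
  move=> sI cs; have [ls _] := lP s sI.
  have cf : frac (gam s') @[s' --> s^'] --> frac (gam s).
    apply: (@continuous_dnbhs _ _ (fun s => frac (gam s))); apply: cvgM.
      exact: (pval_gam_continuous chart gam_ball gam_line sI (near_in_itvoo sI)).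
    apply: cvgV; last exact: (pval_gam_continuous chart gam_ball gam_line sI (near_in_itvoo sI)).
    move: cs; rewrite cE // !pvalM !mulf_eq0 !negb_or.
    by move=> /andP[/andP[]].
  exact: cvg_unique ls cf.
have I0 : (0 : R) \in I by rewrite in_itv /= ltrN10 ltr0n.
have I1 : (1 : R) \in I by rewrite in_itv /= ltr1n andbT (lt_trans (ltrN10 R) ltr01).
have lc : {within `[0, 1], continuous l}.
  apply: continuous_in_subspaceT => s0; rewrite inE /= => s01.
  have s0I : s0 \in I by move: s01; rewrite !in_itv /= => /andP[? ?]; apply/andP; split; lra.
  apply/cvgrPdist_le => d d0.
  have d2 : 0 < d / 2 by rewrite divr_gt0.
  have [/cvgrPdist_lt/(_ _ d2) ls0 _] := lP s0 s0I.
  (* For s' near s0 and distinct from it, p / q is close to [l s0] at all points around s', where it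
     also tends to [l s']; a common point compares the two limits. *)
  have near2 : \forall s' \near s0, s' != s0 ->
      \forall s \near s'^', `|l s0 - frac (gam s)| < d / 2.
    move: ls0 => /nbhs_ballP[r r0 rP]; apply/nbhs_ballP; exists r => // s' s0s' s's0.
    apply: cvg_within.
    have o : open (ball s0 r `&` ~` [set s0]).
      apply: openI; first exact: ball_open.
      by apply: closed_openC; exact: closed_eq.
    have : nbhs s' (ball s0 r `&` ~` [set s0]).
      by apply: open_nbhs_nbhs; split => //; split => //=; apply/eqP.
    by apply: filterS => s [s0s /= /eqP ss0]; exact: rP.
  near=> s'; have [->|s's0] := eqVneq s' s0; first by rewrite subrr normr0 ltW.
  have s'I : s' \in I by near: s'; exact: near_in_itvoo.
  have [/cvgrPdist_lt/(_ _ d2) ls' _] := lP s' s'I.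
  have nn := near near2 s' _ s's0.
  have [|s [h1 h2]] := @filter_ex _ (s'^') _
      ([set s | `|l s0 - frac (gam s)| < d / 2] `&`
       [set s | `|l s' - frac (gam s)| < d / 2]).
    by apply: filterI; [exact: nn|exact: ls'].
  have -> : l s0 - l s' = (l s0 - frac (gam s)) - (l s' - frac (gam s)) by ring.
  apply: le_trans (ler_normB _ _) _.
  by move: h1 h2 => /=; lra.
have [s s01 lst] : exists2 s, s \in `[0, 1] & l s = t.
  apply: IVT => //; rewrite !lE //.
  by rewrite ge_min le_max (ltW f0t) (ltW tf1) orbT.
have sI : s \in I by move: s01; rewrite !in_itv /= => /andP[? ?]; apply/andP; split; lra.
have [_] := lP s sI; rewrite lst => /eqP; apply/negP; exact: tn0.
Unshelve. all: by end_near. Qed.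

End Crossing.

(** * The limit of p / q at a regular point *)

Section LocalLimit.
Variables (R : realType) (n : nat) (X : irrAlgSet R n).
Local Notation poly := (mpoly n R).
Local Notation V := 'rV[R]_n.
Variables (m : nat) (a : nat -> X -> R).
Hypothesis acont : forall i, continuous (a i).
Hypothesis am1 : forall y, a m y = 1.
Variables (p q Q : poly).
Hypothesis pq_root : forall y : X, pval (q * Q) (val y) != 0 ->
  family_eval m a y (pval p (val y) / pval q (val y)) = 0.
Hypothesis qQ0 : restr X (q * Q) != 0.
Variable x : X.
Hypothesis regx : regular_local_ring (local_ring x).
Local Notation x0 := (val x).
Local Notation frac y := (pval p (val y) / pval q (val y)).
Local Notation I := `](-1)%R, 2%R[.

Let Xval (y : X) : irr_set X (val y). Proof. exact/set_mem/(valP y). Qed.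

(* The points where c (y Pi) <> 0 are dense near x, and two of them can be joined
   by a curve to which curve_no_crossing applies. *)
Lemma generic_points : exists2 good : X -> Prop,
  (forall y, good y -> pval (q * Q) (val y) != 0) &
  (exists2 r, 0 < r & forall y : X, `|val y - x0| < r -> forall d, 0 < d ->
     exists2 z, `|val z - val y| < d & good z) /\
  (forall t, family_eval m a x t != 0 -> exists2 r, 0 < r &
     forall y z : X, `|val y - x0| < r -> `|val z - x0| < r -> good y -> good z ->
       [/\ frac y != t, frac z != t & frac y < t -> ~ t < frac z]).
Proof.
have [H [Pi fr]] := exists_local_frame regx.
have [e e0 [chart onto]] := polynomial_chart (jac_frame_map_x0 fr).
have [c [b [[y1 Xy1 cy1] cE]]] := frame_algebraic fr qQ0.
have [r r0 [L LP]] := frame_curves fr e0 chart onto.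
pose k : R := n%:R * `|Pi|.
have k0 : 0 <= k by rewrite mulr_ge0.
have kP (v : V) : `|v *m Pi| <= k * `|v|.
  by apply: mx_norm_mulmx => // i j; exact: mx_norm_ge.
have idPi (v : V) : v *m Pi *m Pi = v *m Pi by rewrite -mulmxA (frame_idem fr).
have I0 : (0 : R) \in I by rewrite in_itv /= ltrN10 ltr0n.
have I1 : (1 : R) \in I.
  by rewrite in_itv /= ltr1n andbT (lt_trans (ltrN10 R) ltr01).
exists (fun y : X => pval c (val y *m Pi) != 0).
  by move=> y; rewrite cE // mulf_eq0 negb_or => /andP[].
split.
  (* The curve starts at [y] in the tangent direction of [y1]. On the corresponding line c is a
     nonzero polynomial, since at parameter 1 / s1 it takes its nonzero value for [y1]; so it is
     nonzero at parameters arbitrarily near 0. *)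
  exists r => // y yr d d0; pose v := (y1 - val y) *m Pi.
  pose s1 := r / (`|v| + 1).
  have v1 : 0 < `|v| + 1 by rewrite ltr_wpDl.
  have s10 : 0 < s1 by rewrite divr_gt0.
  have wr : `|s1 *: v| <= r.
    rewrite normrZ gtr0_norm // /s1 mulrAC ler_pdivrMr //.
    by rewrite ler_pM2l // lerDl.
  have wPi : s1 *: v *m Pi = s1 *: v by rewrite -scalemxAl idPi.
  have [gam [gam0 gb _ gl]] := LP y _ (ltW yr) wr wPi.
  have [u uE] := pval_line c (val (gam 0) *m Pi) (s1 *: v).
  have u0 : u != 0.
    apply: contra_neq cy1 => u0; have := uE s1^-1.
    rewrite u0 horner0 gam0 scalerA mulVf ?gt_eqF // scale1r /v mulmxBl addrC subrK.
    by move=> <-.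
  have cg : {for (0 : R), continuous (fun s => val (gam s))}.
    by apply: (gam_continuous chart gb gl I0); exact: near_in_itvoo.
  have near0 : \forall s \near (0 : R)^', s \in I.
    by apply: cvg_within; exact: near_in_itvoo.
  have nd : \forall s \near (0 : R)^', `|val (gam 0) - val (gam s)| < d.
    by have /cvgrPdist_lt/(_ d d0) := continuous_dnbhs cg.
  have [s [[sI sd] us]] : exists s : R,
      (s \in I /\ `|val (gam 0) - val (gam s)| < d) /\ u.[s] != 0.
    apply: (@filter_ex _ ((0 : R)^')).
    by apply: filterI; [exact: filterI|exact: poly_dnbhs_neq0].
  exists (gam s); first by rewrite distrC -gam0.
  by rewrite (gam_Pi fr wPi gl sI) -uE.
move=> t tx.
have t0 : 0 < `|family_eval m a x t| by rewrite normr_gt0.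
have /continuous_irrP/(_ _ t0)[r1 r10 r1P] := @family_eval_continuous _ _ _ m _ acont t x.
have tn0 (y : X) : `|val y - x0| < r1 -> family_eval m a y t != 0.
  move=> /r1P; apply: contraTneq => ->.
  by rewrite sub0r normrN ltxx.
pose L1 := `|L| + 1.
have L10 : 0 < L1 by rewrite ltr_wpDl.
have k1 : 0 < 1 + 2 * k by rewrite ltr_pwDl // mulr_ge0.
(* Two points within [d] of x have tangent coordinates differing by at most 2 k d. The bounds by [r]
   make the joining curve exist, those by [r1] keep it where [t] is not a root. *)
pose d := Num.min (Num.min e r1) (Num.min (r / (1 + 2 * k)) (r1 / (L1 * (1 + 2 * k)))).
have d0 : 0 < d by rewrite !lt_min e0 r10 !divr_gt0 // mulr_gt0.
exists d => // y z yd zd gy gz.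
have small (u : X) : `|val u - x0| < d -> [/\ `|val u - x0| < e, `|val u - x0| < r1,
    `|val u - x0| * (1 + 2 * k) < r & `|val u - x0| * (L1 * (1 + 2 * k)) < r1].
  by rewrite !lt_min !ltr_pdivlMr ?mulr_gt0 // => /andP[/andP[-> ->] /andP[-> ->]].
have [ye yr1 yr _] := small y yd; have [ze zr1 _ _] := small z zd.
have dr : d * (1 + 2 * k) <= r.
  by rewrite -ler_pdivlMr // /d !ge_min lexx !orbT.
have dr1 : d * (L1 * (1 + 2 * k)) <= r1.
  by rewrite -ler_pdivlMr ?mulr_gt0 // /d !ge_min lexx !orbT.
have nroot (u : X) : `|val u - x0| < r1 -> pval c (val u *m Pi) != 0 -> frac u != t.
  move=> ur1 gu; apply/eqP => E.
  have := tn0 u ur1; rewrite -E pq_root ?eqxx //.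
  by move: gu; rewrite cE // mulf_eq0 negb_or => /andP[].
split; [exact: nroot|exact: nroot|].
pose w := (val z - val y) *m Pi.
have wk : `|w| <= k * (`|val y - x0| + `|val z - x0|).
  apply: le_trans (kP _) _; rewrite ler_wpM2l //.
  have -> : val z - val y = (val z - x0) - (val y - x0) by rewrite opprB addrA subrK.
  by apply: le_trans (ler_normB _ _) _; rewrite addrC.
have wd : `|val y - x0| + `|w| < d * (1 + 2 * k).
  move: wk yd zd; move: `|w| `|_ - _| `|_ - _| => A B C; nra.
have wr : `|w| <= r.
  by apply: le_trans dr; apply: ltW; apply: le_lt_trans wd; rewrite lerDr.
have yr' : `|val y - x0| <= r.
  by apply: le_trans dr; apply: ltW; apply: le_lt_trans wd; rewrite lerDl.
have [gam [gam0 gb gL gl]] := LP y w yr' wr (idPi _).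
(* Points of X near [x0] with equal tangent coordinates coincide, as the chart is injective and
   reduces to y [Pi] on X. *)
have gam1 : gam 1 = z.
  apply: val_inj; apply/eqP; rewrite -subr_eq0 -normr_le0.
  have [_] := chart _ _ (gb _ I1) (ltW ze).
  suff -> : pmap (frame_map H Pi) (val (gam 1)) = pmap (frame_map H Pi) (val z).
    by rewrite subrr normr0 mulr0.
  rewrite /pmap (pval_frame_map fr (Xval z)) (pval_frame_map fr (Xval (gam 1))).
  by rewrite (gam_Pi fr (idPi _) gl I1) gam0 scale1r /w mulmxBl addrC subrK.
rewrite -gam0 -gam1.
apply: (curve_no_crossing acont am1 pq_root fr chart cE (idPi _) gb gl).
- by rewrite gam0.
- by rewrite gam1.
- move=> s sI; apply: tn0; apply: le_lt_trans (gL s sI) _.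
  apply: (@le_lt_trans _ _ (L1 * (`|val y - x0| + `|w|))).
    rewrite ler_wpM2r ?addr_ge0 // /L1; move: (ler_norm L); lra.
  apply: lt_le_trans dr1; rewrite mulrCA ltr_pM2l //.
Qed.

(** The limit is the supremum of the t that stay below p / q at all good points near x; the root
    bound makes it finite. A non-root [t1] just above it cannot be crossed, so p / q stays below
    [t1]. *)
Lemma local_limit :
  (forall d, 0 < d -> exists2 y : X, `|val y - x0| < d & pval (q * Q) (val y) != 0) /\
  exists l, forall d, 0 < d -> exists2 r, 0 < r & forall y : X,
    `|val y - x0| < r -> pval (q * Q) (val y) != 0 -> `|frac y - l| <= d.
Proof.
have [good goodQ [[r r0 dense] cross]] := generic_points.
have xx (d : R) : 0 < d -> `|x0 - x0| < d by rewrite subrr normr0.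
split.
  move=> d d0; have [y yd gy] := dense x (xx r r0) d d0.
  by exists y => //; exact: goodQ.
pose B (y : X) := 1 + \sum_(i < m) `|a i y|.
have cB : {for x, continuous B}.
  have FF : Filter (nbhs x) by exact: nbhs_filter.
  apply: (@cvgD _ _ _ (nbhs x) FF); first exact: cvg_cst.
  apply: (@cvg_finsum _ _ _ (nbhs x)) => i.
  by apply: cvg_norm; exact: acont.
have /continuous_irrP/(_ 1 ltr01)[r1 r10 r1P] := cB.
have bnd (y : X) : `|val y - x0| < r1 -> good y -> `|frac y| <= B x + 1.
  move=> /r1P yB gy; apply: le_trans (family_root_bound am1 (pq_root (goodQ y gy))) _.
  rewrite -/(B y); move: (ler_norm (B y - B x)) yB; lra.
pose S := [set t | exists2 d, 0 < d &
  forall y : X, `|val y - x0| < d -> good y -> t < frac y].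
have supS : has_sup S.
  split.
    exists (- (B x + 1) - 1); exists r1 => // y yr1 gy.
    have := bnd y yr1 gy; rewrite ler_norml => /andP[]; lra.
  exists (B x + 1) => t [d d0 dP].
  have [|y yd gy] := dense x (xx r r0) (Num.min d r1); first by rewrite lt_min d0.
  move: yd; rewrite lt_min => /andP[yd yr1].
  have := dP y yd gy; have := bnd y yr1 gy; rewrite ler_norml => /andP[_]; lra.
exists (sup S) => d d0.
have [|t1 /andP[t1S t1d] t1n0] := @family_nonroot _ _ _ m a am1 x (sup S) (sup S + d).
  by rewrite ltrDl.
have [d1 d10 d1P] := cross t1 t1n0.
have [t0 [d2 d20 d2P] t0S] := sup_adherent d0 supS.
(* If p / q exceeded [t1] at one good point, it would do so at all good points near x, and [t1]
   would belong to [S]. *)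
have up (y : X) : `|val y - x0| < d1 -> good y -> frac y < t1.
  move=> yd1 gy; have [yt1 _ _] := d1P y y yd1 yd1 gy gy.
  rewrite lt_neqAle yt1 leNgt; apply/negP => t1y.
  suff t1in : S t1.
    by have := ub_le_sup (proj2 supS) t1in; rewrite leNgt t1S.
  exists d1 => // z zd1 gz; have [zt1 _ nz] := d1P z y zd1 yd1 gz gy.
  by rewrite ltNge le_eqVlt (negbTE zt1) /=; apply/negP => /nz.
pose rr := Num.min (Num.min d1 d2) r.
have rr0 : 0 < rr by rewrite !lt_min d10 d20.
have gl (y : X) : `|val y - x0| < rr -> good y -> `|frac y - sup S| < d.
  rewrite !lt_min => /andP[/andP[yd1 yd2] _] gy.
  have := up y yd1 gy; have := d2P y yd2 gy; move: t0S t1d; rewrite ltr_norml.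
  by move=> ? ? ? ?; apply/andP; split; lra.
(* From good points to all points with q Q nonzero: p / q is continuous there, so a strict violation
   would persist at a nearby good point. *)
exists rr => // y yrr Qy; rewrite leNgt; apply/negP => far.
have q0 : pval q (val y) != 0 by move: Qy; rewrite pvalM mulf_eq0 negb_or => /andP[].
have cfr : {for y, continuous (fun y : X => frac y)}.
  have FF : Filter (nbhs y) by exact: nbhs_filter.
  have cp (g : poly) : {for y, continuous (fun y : X => pval g (val y))}.
    apply/continuous_irrP => d' d'0.
    have /cvgrPdist_lt/(_ d' d'0)/nbhs_ballP[r' r'0 r'P] := @pval_continuous R n g (val y).
    exists r' => // z zr'; rewrite distrC; apply: r'P.
    by rewrite -ball_normE /ball_ /= distrC.
  by apply: (@cvgM _ _ (nbhs y) FF); [exact: cp|apply: (@cvgV _ _ (nbhs y) FF) => //; exact: cp].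
pose eta := `|frac y - sup S| - d.
have eta0 : 0 < eta by rewrite subr_gt0.
have /continuous_irrP/(_ _ eta0)[r2 r20 r2P] := cfr.
have yr : `|val y - x0| < r by move: yrr; rewrite !lt_min => /andP[].
have [|z zy gz] := dense y yr (Num.min r2 (rr - `|val y - x0|)).
  by rewrite lt_min r20 subr_gt0.
move: zy; rewrite lt_min => /andP[/r2P zf zrr].
have zrr' : `|val z - x0| < rr.
  have -> : val z - x0 = (val z - val y) + (val y - x0) by rewrite addrA subrK.
  by apply: le_lt_trans (ler_normD _ _) _; rewrite -ltrBrDr.
have := gl z zrr' gz.
have := ler_normB (frac z - sup S) (frac z - frac y).
have -> : frac z - sup S - (frac z - frac y) = frac y - sup S by ring.
by move: zf; rewrite /eta; lra.
Qed.

End LocalLimit.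

(** * Rational functions and their values *)

Lemma fraction_tofrac (D : idomainType) (z : {fraction D}) :
  exists a b : D, b != 0 /\ z * FracField.tofrac b = FracField.tofrac a.
Proof.
elim/quotW: z => r; exists (frac r).1, (frac r).2; split; first exact: denom_ratioP.
change (FracField.mul (\pi_(FracField.type D) r) (FracField.tofrac (frac r).2) =
  FracField.tofrac (frac r).1).
apply/eqP; rewrite !piE /FracField.equivf /FracField.mulf.
by rewrite !numden_Ratio ?mulf_neq0 ?oner_eq0 ?denom_ratioP // !mulr1 mulrC.
Qed.

(** Used both in K(X) and in R at a point of X, to carry an equation from the first to the
    second. *)
Lemma clear_denominators (F : fieldType) (m : nat) (P D : 'I_m.+1 -> F) (p q : F) :
  q != 0 -> (forall i, D i != 0) ->
  \sum_i P i * (\prod_(j | j != i) D j) * p ^+ i * q ^+ (m - i) =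
  (\prod_j D j) * q ^+ m * \sum_i P i / D i * (p / q) ^+ i.
Proof.
move=> q0 D0; rewrite mulr_sumr; apply: eq_bigr => i _.
have -> : q ^+ m = q ^+ (m - i) * q ^+ i by rewrite -exprD subnK // -ltnS.
rewrite [\prod_j D j](bigD1 i) //= expr_div_n.
have qi : q ^+ i != 0 by rewrite expf_neq0.
by field; rewrite D0 qi.
Qed.

Section Glue.
Variables (R : realType) (n : nat) (X : irrAlgSet R n).
Local Notation poly := (mpoly n R).

Let Xval (y : X) : irr_set X (val y). Proof. exact/set_mem/(valP y). Qed.

Lemma rat_field_fraction (z : rat_field X) :
  exists p q : poly, restr X q != 0 /\ z = restr X p / restr X q.
Proof.
have [a [b [b0 E]]] := fraction_tofrac z.
exists (repr a), (repr b); rewrite /restr !polyfun_repr.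
have b0' : FracField.tofrac b != 0 :> rat_field X by rewrite tofrac_eq0.
by split=> //; rewrite -E mulfK.
Qed.

(** The open set where g is a fraction is shrunk to the locus where one equation [s] of its
    complement is nonzero. *)
Lemma cont_rat_fraction (g : cont_rat X) : exists p q s : poly,
  [/\ restr X q != 0, restr X s != 0, cont_rat_class g = restr X p / restr X q
  & forall y : X, pval s (val y) != 0 ->
      pval q (val y) != 0 /\ g y = pval p (val y) / pval q (val y)].
Proof.
have /asboolP[_ [p [q gpq]]] := cont_ratP g.
have [U [[Y algY UE] dU UP]] := gpq.
have [[x0 Xx0] _] := irr_set_irreducible X.
have [u Uu] : U !=set0.
  apply/set0P/eqP => U0; have := dU set0 (real_algebraic0 R n) _ x0 Xx0.
  by rewrite U0; apply.
have [S YE] := algY.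
have [s Ss su] : exists2 s, S s & pval s u != 0.
  apply: contrapT => nS; move: Uu; rewrite UE => -[_]; apply; rewrite YE => s Ss.
  by apply/eqP/negPn/negP => su; apply: nS; exists s.
have Xu : irr_set X u by move: Uu; rewrite UE => -[].
exists p, q, s; split.
- exact: is_fraction_neq0 gpq.
- exact: restr_neq0 Xu su.
- exact: cont_rat_classE.
- move=> y sy; apply: UP; rewrite UE; split=> //; rewrite YE => /(_ s Ss) s0.
  by rewrite s0 eqxx in sy.
Qed.

(** X is the union of its intersections with Y and with the zeros of q; irreducibility leaves only
    the first. *)
Lemma zariski_dense_nonzero (q : poly) : restr X q != 0 ->
  zariski_dense_in X (irr_set X `\` [set y | pval q y = 0]).
Proof.
move=> q0 Y algY UY.
have [_ irr] := irr_set_irreducible X; have algX := irr_set_algebraic X.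
have [|||XE|XE] := irr (irr_set X `&` Y) (irr_set X `&` [set y | pval q y = 0]).
- exact: real_algebraicI.
- by apply: real_algebraicI => //; exact: real_algebraic1.
- apply/seteqP; split=> [y Xy|y [] []//].
  have [qy|qy] := pselect (pval q y = 0); first by right.
  by left; split=> //; exact: UY.
- by move=> y; rewrite XE => -[].
- move: q0 => /eqP []; apply/restr_eq0 => y.
  by rewrite XE => -[].
Qed.

(** Cleared of denominators, the equation in K(X) says that a polynomial [T] vanishes on X, and this
    can be evaluated wherever the denominators are nonzero. *)
Lemma integral_equation (P : {poly cont_rat X}) (p q : poly) :
  restr X q != 0 -> root (map_poly (@cont_rat_class R n X) P) (restr X p / restr X q) ->
  exists2 Q : poly, restr X (q * Q) != 0 & forall y : X, pval (q * Q) (val y) != 0 ->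
    \sum_(i < size P) (P`_i : cont_rat X) y * (pval p (val y) / pval q (val y)) ^+ i = 0.
Proof.
move=> q0; case: (posnP (size P)) => [sP|sP] rootP.
  exists 1; first by rewrite mulr1.
  by move=> y _; rewrite sP big_ord0.
have exF (i : nat) : exists t : poly * poly * poly,
  [/\ restr X t.1.2 != 0, restr X t.2 != 0,
      cont_rat_class (P`_i : cont_rat X) = restr X t.1.1 / restr X t.1.2
  & forall y : X, pval t.2 (val y) != 0 -> pval t.1.2 (val y) != 0 /\
      (P`_i : cont_rat X) y = pval t.1.1 (val y) / pval t.1.2 (val y)].
  by have [a [b [s abs]]] := cont_rat_fraction (P`_i); exists (a, b, s).
have [t tP] := choice exF.
pose m := (size P).-1; have mE : size P = m.+1 by rewrite prednK.
pose T : poly := \sum_(i < m.+1)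
  (t i).1.1 * (\prod_(j < m.+1 | j != i) (t j).1.2) * p ^+ i * q ^+ (m - i).
have restrX g k : restr X (g ^+ k) = restr X g ^+ k by exact: rmorphXn.
have restr_prod (J : finType) (A : pred J) (F : J -> poly) :
  restr X (\prod_(j | A j) F j) = \prod_(j | A j) restr X (F j) by exact: rmorph_prod.
have pvalXn g k y : pval (g ^+ k) y = pval g y ^+ k :> R by exact: (rmorphXn (meval _)).
have T0 : restr X T = 0.
  pose A (i : 'I_m.+1) := restr X (t i).1.1; pose D (i : 'I_m.+1) := restr X (t i).1.2.
  have D0 (i : 'I_m.+1) : D i != 0 := let: And4 h _ _ _ := tP i in h.
  have -> : restr X T = \sum_i A i * (\prod_(j | j != i) D j) *
      restr X p ^+ i * restr X q ^+ (m - i).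
    by rewrite restr_sum; apply: eq_bigr => i _; rewrite !restrM restr_prod !restrX.
  rewrite (@clear_denominators _ m A D (restr X p) (restr X q) q0 D0).
  suff -> : \sum_i A i / D i * (restr X p / restr X q) ^+ i = 0 by rewrite mulr0.
  move: rootP => /rootP; rewrite (horner_coef_wide _ (size_poly _ _)) mE => E.
  rewrite -[RHS]E; apply: eq_bigr => i _; rewrite coef_poly ltn_ord.
  by have [_ _ -> _] := tP i.
pose Q : poly := \prod_(j < m.+1) (t j).2.
exists Q.
  rewrite restrM; apply: (mulf_neq0 q0); rewrite restr_prod; apply/prodf_neq0 => j _.
  by have [_ + _ _] := tP j; exact.
move=> y; rewrite pvalM mulf_eq0 negb_or => /andP[qy]; rewrite pval_prod => /prodf_neq0 sy.
have ty (j : 'I_m.+1) := tP j.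
have Dy (j : 'I_m.+1) : pval (t j).1.2 (val y) != 0.
  by have [_ _ _ /(_ y (sy j isT))[]] := tP j.
have := (restr_eq0 X T).1 T0 _ (Xval y).
pose A (i : 'I_m.+1) := pval (t i).1.1 (val y).
pose D (i : 'I_m.+1) := pval (t i).1.2 (val y).
have -> : pval T (val y) = \sum_i A i * (\prod_(j | j != i) D j) *
    pval p (val y) ^+ i * pval q (val y) ^+ (m - i).
  by rewrite pval_sum; apply: eq_bigr => i _; rewrite !pvalM pval_prod !pvalXn.
rewrite (@clear_denominators _ m A D (pval p (val y)) (pval q (val y)) qy Dy) => /eqP.
rewrite mulf_eq0 mulf_eq0 expf_eq0 (negbTE qy) andbF orbF.
have /negbTE -> : \prod_j D j != 0 by apply/prodf_neq0 => j _; exact: Dy.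
move=> /eqP E; rewrite mE -[RHS]E; apply: eq_bigr => i _.
by have [_ _ _ /(_ y (sy i isT))[_ ->]] := tP i.
Qed.

End Glue.

Theorem corollary5p8 (R : realType) (n : nat) (X : irrAlgSet R n)
    (nsX : nonsingular X) :
  integrally_closed_in (@cont_rat_class R n X).
Proof.
move=> z [P monP rootP].
have [p [q [q0 zE]]] := rat_field_fraction z; rewrite zE in rootP.
have [Q qQ0 PQ] := integral_equation q0 rootP.
pose m := (size P).-1.
have mE : size P = m.+1 by rewrite prednK // size_poly_gt0 monic_neq0.
pose a i (y : X) : R := (P`_i : cont_rat X) y.
have acont i : continuous (a i) by have /asboolP[] := cont_ratP (P`_i).
have am1 y : a m y = 1 by rewrite /a -/(lead_coef P) (monicP monP).
have rootF (y : X) : pval (q * Q) (val y) != 0 ->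
    family_eval m a y (pval p (val y) / pval q (val y)) = 0.
  by move=> /PQ; rewrite mE.
have lim x := local_limit acont am1 rootF qQ0 (nsX x).
have [F FP] := choice (fun x => (lim x).2).
have Fcont : continuous F.
  move=> x; apply/continuous_irrP => d d0.
  (* A point [u] with q Q nonzero is chosen close to [y] and in the ball around [x]: there p / q is
     within d / 4 of both [F x] and [F y]. *)
  have d4 : 0 < d / 4 by rewrite divr_gt0.
  have [r r0 rP] := FP x _ d4; exists r => // y yr.
  have [r' r'0 r'P] := FP y _ d4.
  have [|u uy Qu] := (lim y).1 (Num.min r' (r - `|val y - val x|)).
    by rewrite lt_min r'0 subr_gt0.
  move: uy; rewrite lt_min => /andP[uy ux].
  have ux' : `|val u - val x| < r.
    have -> : val u - val x = (val u - val y) + (val y - val x) by rewrite addrA subrK.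
    by apply: le_lt_trans (ler_normD _ _) _; rewrite -ltrBrDr.
  have := rP u ux' Qu; have := r'P u uy Qu.
  move: (pval p _ / _) => f h1 h2.
  have -> : F y - F x = (f - F x) - (f - F y) by ring.
  apply: le_lt_trans (ler_normB _ _) _; lra.
have Ffrac : is_fraction F p q.
  exists (irr_set X `\` [set y | pval (q * Q) y = 0]); split.
  - by exists [set y | pval (q * Q) y = 0] => //; exact: real_algebraic1.
  - exact: zariski_dense_nonzero.
  move=> y [_ /eqP Qy]; split.
    by move: Qy; rewrite pvalM mulf_eq0 negb_or => /andP[].
  (* Where q Q is nonzero, [y] itself is an admissible point for its own limit, so p / q at [y] is
     within every positive d of [F y]. *)
  apply/eqP; rewrite eq_sym -subr_eq0 -normr_le0; apply/ler_addgt0Pr => d d0.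
  have [r r0 rP] := FP y d d0.
  by rewrite add0r; apply: rP => //; rewrite subrr normr0.
have FK : continuous_rational F by apply/asboolP; split=> //; exists p, q.
exists (ContRat FK); rewrite zE.
exact: (@cont_rat_classE R n X (ContRat FK) p q Ffrac).
Qed.
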